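(* Let $(X,\tau)$ be a locally compact Hausdorff space, $\nu$ be a strictly positive, $\sigma$-finite Borel measure on $X$, and $k$ be a $C_0(X)$-kernel satisfying $\int_Xk(x,x)\,\mathrm d\nu(x)<\infty$. In addition, let $(e_i)_{i\in I}$ be the eigenfunctions of $T_{k,\nu}$ described in the context. Then the following statements are equivalent: (i) $k$ is universal. (ii) For all $\mu\in\mathcal M^*(X)$ satisfying $\int_Xe_i\,\mathrm d\mu=0$ for all $i\in I$ we have $\mu=0$. (iii) The space $\operatorname{span}\{e_i:i\in I\}$ is dense in $C_0(X)$. If one, and thus all, statements are true and $\nu\in\mathcal M^*(X)$, then $([e_i]_\sim)_{i\in I}$ is an orthonormal basis of $L_2(\nu)$.
   Context: A kernel on $X$ is a symmetric positive definite function $k:X\times X\to\mathbb R$ (i.e. $\sum_{i,j}a_ia_jk(x_i,x_j)\ge0$ for all finite choices). $C_0(X)$ is the space of continuous real functions on $X$ vanishing at infinity, with the supremum norm. A $C_0(X)$-kernel is a bounded and continuous kernel $k$ on $X$ whose reproducing kernel Hilbert space $H$ satisfies $H\subset C_0(X)$. A continuous kernel $k$ with RKHS $H$ is universal if $H\subset C_0(X)$ and $H$ is dense in $C_0(X)$ in the supremum norm. A measure $\nu$ on the Borel $\sigma$-algebra $\mathcal B(X)$ is a Borel measure if $\nu(K)<\infty$ for all compact $K$, and it is strictly positive if $\nu(O)>0$ for all non-empty open $O$. $\mathcal M^*(X)$ is the space of finite signed Radon measures, i.e. differences of two finite measures $\mu$ on $\mathcal B(X)$ with $\mu(B)=\sup\{\mu(K):K\text{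 compact},K\subset B\}=\inf\{\mu(O):O\text{ open},B\subset O\}$ for all $B\in\mathcal B(X)$. $[f]_\sim$ denotes the $\nu$-equivalence class of $f$. Under the integrability assumption, $I_{k,\nu}:H\to L_2(\nu)$, $f\mapsto[f]_\sim$, is well-defined and Hilbert–Schmidt, and $T_{k,\nu}:=I_{k,\nu}\circ I_{k,\nu}^*$, i.e. $T_{k,\nu}f=[\int_Xk(x,\cdot)f(x)\,\mathrm d\nu(x)]_\sim$, is compact, positive and self-adjoint on $L_2(\nu)$. $(\lambda_i)_{i\in I}\subset(0,\infty)$ is the at most countable family of its non-zero eigenvalues including multiplicities, and $(e_i)_{i\in I}\subset H$ is a family such that $([e_i]_\sim)_{i\in I}$ is an orthonormal system in $L_2(\nu)$ of corresponding eigenfunctions and $(\sqrt{\lambda_i}e_i)_{i\in I}$ is an orthonormal system in $H$. In the present situation $k(x,x')=\sum_{i\in I}\lambda_ie_i(x)e_i(x')$ for all $x,x'\in X$. *)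

(* Defs.v *)
From HB Require Import structures.
From mathcomp Require Import all_boot all_order all_algebra.
From mathcomp Require Import all_classical all_reals all_analysis.

Set Implicit Arguments.
Unset Strict Implicit.
Unset Printing Implicit Defensive.

Import Order.TTheory GRing.Theory Num.Theory.
Import numFieldNormedType.Exports.

Local Open Scope classical_set_scope.
Local Open Scope ring_scope.

Section function_spaces.
Context {R : realType} {X : ptopologicalType}.
Implicit Types (A B : set (X -> R)) (f : X -> R).

Definition fun_span A : set (X -> R) :=
  [set f | exists n (c : 'I_n -> R) (g : 'I_n -> X -> R),
     (forall j, A (g j)) /\ f = (fun x => \sum_(j < n) c j * g j x)].

Definition C0 : set (X -> R) :=
  [set f | continuous f /\
     forall eps : R, 0 < eps -> compact [set x | eps <= `|f x|]].

(* [sup] is 0 on sets without upper bound; this never happens below since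
   functions in [C0] are bounded. *)
Definition sup_norm f : R := sup [set `|f x| | x in [set: X]].

Definition sup_dense A B : Prop :=
  A `<=` B /\
  forall f, B f -> forall eps : R, 0 < eps ->
    exists2 g, A g & sup_norm (fun x => f x - g x) < eps.

End function_spaces.

Section kernels.
Context {R : realType} {X : ptopologicalType}.
Implicit Types (k : X -> X -> R) (H : set (X -> R)).
Implicit Types (ip : (X -> R) -> (X -> R) -> R).

Definition is_kernel k : Prop :=
  (forall x y, k x y = k y x) /\
  forall n (a : 'I_n -> R) (x : 'I_n -> X),
    0 <= \sum_(i < n) \sum_(j < n) a i * a j * k (x i) (x j).

Definition ip_norm ip (f : X -> R) : R := Num.sqrt (ip f f).

(* The set [H] of functions, with [ip] as inner product, is a Hilbert space;
   the values of [ip] outside of [H] are irrelevant. *)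
Record function_hilbert_space H ip : Prop := {
  hilbert_zero : H (fun=> 0) ;
  hilbert_lin : forall (a : R) f g, H f -> H g -> H (fun x => a * f x + g x) ;
  hilbert_ip_lin : forall (a : R) f g h, H f -> H g -> H h ->
    ip (fun x => a * f x + g x) h = a * ip f h + ip g h ;
  hilbert_ip_sym : forall f g, H f -> H g -> ip f g = ip g f ;
  hilbert_ip_ge0 : forall f, H f -> 0 <= ip f f ;
  hilbert_ip_eq0 : forall f, H f -> ip f f = 0 -> f = (fun=> 0) ;
  hilbert_complete : forall u : nat -> X -> R, (forall n, H (u n)) ->
    (forall eps : R, 0 < eps -> exists N, forall m n, (N <= m)%N -> (N <= n)%N ->
       ip_norm ip (fun x => u m x - u n x) < eps) ->
    exists2 f, H f & ip_norm ip (fun x => u n x - f x) @[n --> \oo] --> (0 : R)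
}.

(* By Moore-Aronszajn, for each kernel [k] there are a unique [H] and an [ip],
   unique on [H], with this property. *)
Record is_rkhs k H ip : Prop := {
  rkhs_hilbert : function_hilbert_space H ip ;
  rkhs_section : forall x, H (k x) ;
  rkhs_reproducing : forall f x, H f -> f x = ip f (k x)
}.

(* In the next two definitions, [H] stands for the RKHS of [k]. *)
Definition C0_kernel k H : Prop :=
  [/\ is_kernel k,
      exists M : R, forall x y, `|k x y| <= M,
      continuous (fun p : X * X => k p.1 p.2) &
      H `<=` C0].

Definition universal_kernel k H : Prop :=
  [/\ is_kernel k,
      continuous (fun p : X * X => k p.1 p.2) &
      sup_dense H C0].

End kernels.

Definition borel_type (X : ptopologicalType) := g_sigma_algebraType (@open X).

Section measures.
Context {R : realType} {X : ptopologicalType}.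
Local Open Scope ereal_scope.

Definition borel_measure (nu : {measure set (borel_type X) -> \bar R}) : Prop :=
  forall K : set X, compact K -> nu K < +oo.

Definition strictly_positive (nu : {measure set (borel_type X) -> \bar R}) :
    Prop :=
  forall O : set X, open O -> O !=set0 -> 0 < nu O.

Definition regular_measure (m : {measure set (borel_type X) -> \bar R}) : Prop :=
  forall A : set (borel_type X), measurable A ->
    m A = ereal_sup [set m K | K in [set K : set X | compact K /\ K `<=` A]] /\
    m A = ereal_inf [set m O | O in [set O : set X | open O /\ A `<=` O]].

(* Stated for arbitrary set functions so that it applies to charges as well as
   to measures. *)
Definition finite_signed_radon (mu : set (borel_type X) -> \bar R) : Prop :=
  exists m1 m2 : {finite_measure set (borel_type X) -> \bar R},
    [/\ regular_measure m1, regular_measure m2 &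
        forall A, measurable A -> mu A = m1 A - m2 A].

End measures.

Section charge_integral.
Context d {T : measurableType d} {R : realType}.
Variable mu : {charge set T -> \bar R}.

Let hahn_pos : {P | exists N, hahn_decomposition mu P N} :=
  cid (Hahn_decomposition mu).
Let hahn_neg : {N | hahn_decomposition mu (sval hahn_pos) N} :=
  cid (svalP hahn_pos).

Definition charge_integral (f : T -> R) : R :=
  Rintegral (jordan_pos (svalP hahn_neg)) setT f -
  Rintegral (jordan_neg (svalP hahn_neg)) setT f.

End charge_integral.

(* Elements of L_2(nu) are represented by functions in [Lfun nu 2], equality of
   classes being equality nu-almost everywhere. *)
Section L2.
Context {R : realType} {X : ptopologicalType}.
Variable nu : {measure set (borel_type X) -> \bar R}.

Definition L2_orthonormal (I : eqType) (e : I -> X -> R) : Prop :=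
  (forall i, (e i : borel_type X -> R) \in Lfun nu 2%:E) /\
  forall i j, Rintegral nu setT (fun x => e i x * e j x) = (i == j)%:R.

Definition L2_orthonormal_basis (I : eqType) (e : I -> X -> R) : Prop :=
  L2_orthonormal e /\
  forall f : borel_type X -> R, f \in Lfun nu 2%:E ->
    forall eps : R, 0 < eps ->
    exists2 g, fun_span (range e) g &
      ('N[nu]_2%:E[EFin \o (fun x => f x - g x)%R] < eps%:E)%E.

(* A representative of T_{k,nu} f. *)
Definition kernel_operator (k : X -> X -> R) (f : X -> R) : X -> R :=
  fun y => Rintegral nu setT (fun x => k x y * f x).

Definition eigen_eq (k : X -> X -> R) (lam : R) (f : X -> R) : Prop :=
  (kernel_operator k f : borel_type X -> R) = (fun y => lam * f y) %[ae nu].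

(* [eigen_all] says that, for each a != 0, the classes of the e_i with
   lam_i = a span the whole eigenspace of a, so that a occurs in lam exactly as
   often as its multiplicity (and does not occur if it is not an eigenvalue). *)
Record eigen_system (k : X -> X -> R) (H : set (X -> R))
    (ip : (X -> R) -> (X -> R) -> R)
    (I : eqType) (lam : I -> R) (e : I -> X -> R) : Prop := {
  eigen_gt0 : forall i, 0 < lam i ;
  eigen_rkhs : forall i, H (e i) ;
  eigen_L2 : L2_orthonormal e ;
  eigen_eigen : forall i, eigen_eq k (lam i) (e i) ;
  eigen_H : forall i j,
    ip (fun x => Num.sqrt (lam i) * e i x) (fun x => Num.sqrt (lam j) * e j x)
    = (i == j)%:R ;
  eigen_all : forall (a : R) (f : borel_type X -> R), a != 0 ->
    f \in Lfun nu 2%:E -> eigen_eq k a f ->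
    exists2 g : borel_type X -> R,
      fun_span (e @` [set i | lam i = a]) g & f = g %[ae nu]
}.

End L2.

(* Main.v *)
Require Import Defs.
From HB Require Import structures.
From mathcomp Require Import all_boot all_order all_algebra.
From mathcomp Require Import finmap.
From mathcomp Require Import all_classical all_reals all_analysis.
From mathcomp Require Import measurable_realfun.
From mathcomp Require Import ring lra.

Set Implicit Arguments.
Unset Strict Implicit.
Unset Printing Implicit Defensive.

Import Order.TTheory GRing.Theory Num.Theory.
Import numFieldNormedType.Exports.

Local Open Scope classical_set_scope.
Local Open Scope ring_scope.

(* By Hahn-Banach and the Riesz-Markov theorem, a subspace of C_0(X) is dense
   if and only if no non-zero finite signed Radon measure annihilates it; for
   the span of the e_i this is the equivalence of (ii) and (iii).

   Convergence in the RKHS implies uniform convergence since k is bounded, so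
   (i) and (iii) are equivalent once the span of the e_i is dense in H. Let f in
   H be orthogonal to all e_i. The quadratic form q(f) = int f^2 dnu is weakly
   sequentially continuous on the unit ball of H, by dominated convergence with
   f_n(x)^2 <= k(x,x). If the orthogonal complement of the e_i were non-zero, q
   would attain a positive maximum on its unit ball, and a maximiser would be
   an eigenfunction of T_{k,nu} outside of the span of the e_i. Strict
   positivity of nu turns nu-a.e. equalities of elements of H into equalities.

   Finally, C_0(X) is dense in L_2(nu) for a finite Radon measure nu. *)

(** * Functions vanishing at infinity *)

Section C0_functions.
Context {R : realType} {X : ptopologicalType}.
Implicit Types (f g : X -> R).

(** Measures are represented from additive positive functionals on the cone of non-negative
    functions in [C0]: the positive part of a bounded functional is a supremum there, and
    [f = (|f| + f) - |f|] leads back to all of [C0]. As these functions need not have compact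
    support, they are cut to [(f - d)^+], which lives on a compact level set; the bound on the
    functional makes the loss small uniformly in [f].

    The eigenvalue argument stays inside H. By the reproducing property the integral operator T maps
    H to H and satisfies [q(h, g) = ip h (T g)]. Since q is symmetric, T is self-adjoint for [ip]
    and preserves the orthogonal complement of its eigenfunctions [e_i]. An eigenfunction found in
    that complement is a combination of the [e_i] by completeness of the multiplicities, hence
    orthogonal to itself, which is the contradiction.

    For the last claim, [nu = m1 - m2] gives [nu <= m1] with [m1] regular, and this domination
    carries the approximation of indicators from [m1] over to [nu]. *)

Lemma closed_level f (eps : R) : continuous f -> closed [set x | eps <= f x].
Proof.
move=> cf; apply: (@preimage_closed _ _ f [set y | eps <= y]); last exact: closed_ge.
by move=> x _; exact: cf.
Qed.

Lemma continuous_abs f : continuous f -> continuous (fun x => `|f x|).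
Proof. by move=> cf x; apply: continuous_comp; [exact: cf|exact: norm_continuous]. Qed.

Lemma C0_dominated f g (c : R) : C0 f -> continuous g ->
  (forall x, `|g x| <= c * `|f x|) -> C0 g.
Proof.
move=> [cf Kf] cg gf; split => // eps eps0.
(* [c] may be zero or negative; [|c| + 1] is a positive upper bound by which one can divide. *)
have c1 : 0 < `|c| + 1 by rewrite ltr_pwDr.
apply: (@subclosed_compact _ _ [set x | eps / (`|c| + 1) <= `|f x|]).
- exact/closed_level/continuous_abs.
- by apply: Kf; rewrite divr_gt0.
- move=> x /= ex; rewrite ler_pdivrMr// (le_trans ex)// (le_trans (gf x))// mulrC.
  by rewrite ler_wpM2l// (le_trans (ler_norm _))// lerDl.
Qed.

Lemma C0_lin (a : R) f g : C0 f -> C0 g -> C0 (fun x => a * f x + g x).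
Proof.
move=> Cf Cg.
have cc : continuous (fun x => a * f x + g x).
  move=> x; apply: cvgD; last exact: Cg.1.
  by apply: cvgM; [exact: cvg_cst|exact: Cf.1].
split => // eps eps0.
have [Kf Kg] := (Cf.2, Cg.2).
have c1 : 0 < `|a| + 1 by rewrite ltr_pwDr.
apply: (@subclosed_compact _ _
    ([set x | eps / 2 / (`|a| + 1) <= `|f x|] `|` [set x | eps / 2 <= `|g x|])).
- exact/closed_level/continuous_abs.
- by apply: compactU; [apply: Kf|apply: Kg]; rewrite ?divr_gt0.
- move=> x /= ex; apply/orP; rewrite -implyNb -ltNge; apply/implyP => fx.
  rewrite ltr_pdivlMr// in fx.
  have : `|a * f x + g x| <= `|f x| * (`|a| + 1) + `|g x|.
    rewrite (le_trans (ler_normD _ _))// lerD2r normrM mulrC ler_wpM2l//.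
    by rewrite lerDl.
  by move: fx; lra.
Qed.

Lemma C0_zero : C0 (fun _ : X => 0 : R).
Proof.
split; first exact: cst_continuous.
move=> eps eps0; rewrite (_ : [set _ | _] = set0); first exact: compact0.
by rewrite -subset0 => x /=; rewrite normr0 leNgt eps0.
Qed.

Lemma C0_add f g : C0 f -> C0 g -> C0 (fun x => f x + g x).
Proof.
move=> Cf Cg; rewrite (_ : (fun x => _) = (fun x => 1 * f x + g x)).
  exact: C0_lin.
by apply/funext => x; rewrite mul1r.
Qed.

Lemma C0_scale (a : R) f : C0 f -> C0 (fun x => a * f x).
Proof.
move=> Cf; rewrite (_ : (fun x => _) = (fun x => a * f x + (fun=> 0) x)).
  exact/C0_lin/C0_zero.
by apply/funext => x; rewrite addr0.
Qed.

Lemma C0_sub f g : C0 f -> C0 g -> C0 (fun x => f x - g x).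
Proof.
move=> Cf Cg; rewrite (_ : (fun x => _) = (fun x => (-1) * g x + f x)).
  exact: C0_lin.
by apply/funext => x; rewrite mulN1r addrC.
Qed.

Lemma C0_sum (J : Type) (s : seq J) (P : pred J) (F : J -> X -> R) :
  (forall j, C0 (F j)) -> C0 (fun x => \sum_(j <- s | P j) F j x).
Proof.
move=> CF; elim: s => [|j s ih].
  rewrite (_ : (fun x => _) = fun=> 0); first exact: C0_zero.
  by apply/funext => x; rewrite big_nil.
rewrite (_ : (fun x => _) =
    if P j then fun x => F j x + \sum_(j <- s | P j) F j x
    else fun x => \sum_(j <- s | P j) F j x); first by case: ifP => // _; exact: C0_add.
by apply/funext => x; rewrite big_cons; case: ifP.
Qed.

Lemma fun_span0 (A : set (X -> R)) : fun_span A (fun=> 0).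
Proof.
exists 0, (fun=> 0), (fun _ _ => 0); split; first by case.
by apply/funext => x; rewrite big_ord0.
Qed.

Lemma fun_span_lin (A : set (X -> R)) (a : R) f g :
  fun_span A f -> fun_span A g -> fun_span A (fun x => a * f x + g x).
Proof.
move=> [n [c [u [Au ->]]]] [m [d [v [Av ->]]]].
exists (n + m)%N,
  (fun i => match fintype.split i with inl j => a * c j | inr j => d j end),
  (fun i => match fintype.split i with inl j => u j | inr j => v j end).
split; first by move=> i; case: (fintype.split i).
apply/funext => x; rewrite big_split_ord/= mulr_sumr; congr (_ + _).
  by apply: eq_bigr => i _; rewrite (unsplitK (inl i)) mulrA.
by apply: eq_bigr => i _; rewrite (unsplitK (inr i)).
Qed.

Lemma sub_fun_span (A : set (X -> R)) : A `<=` fun_span A.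
Proof.
move=> f Af; exists 1, (fun=> 1), (fun=> f); split => //.
by apply/funext => x; rewrite big_ord1 mul1r.
Qed.

Lemma C0_span (A : set (X -> R)) : A `<=` C0 -> fun_span A `<=` C0.
Proof.
move=> AC _ [n [c [g [Ag ->]]]]; apply: C0_sum => j.
by apply: C0_scale; exact: AC.
Qed.

Lemma C0_bounded f : C0 f -> exists M, forall x, `|f x| <= M.
Proof.
move=> [cf Kf]; have /Kf K1 : 0 < 1 :> R by [].
have := continuous_compact (continuous_subspaceT cf) K1.
move=> /compact_bounded [M [Mr bM]].
exists (Num.max 1 (M + 1)) => x; have [fx|fx] := leP `|f x| 1.
  by rewrite le_max fx.
rewrite le_max; apply/orP; right; apply: (bM (M + 1)); first by rewrite ltrDl.
by exists x => //=; exact: ltW.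
Qed.

Lemma ler_sup_norm f x : C0 f -> `|f x| <= sup_norm f.
Proof.
move=> /C0_bounded[M fM]; apply: sup_upper_bound; last by exists x.
split; first by exists `|f x|, x.
by exists M => _ [y _ <-].
Qed.

Lemma sup_norm_ler f (c : R) : (forall x, `|f x| <= c) -> sup_norm f <= c.
Proof.
move=> fc; apply: ge_sup; first by exists `|f point|, point.
by move=> _ [x _ <-].
Qed.

Lemma sup_norm_ge0 f : C0 f -> 0 <= sup_norm f.
Proof. by move=> Cf; apply: le_trans (ler_sup_norm point Cf). Qed.

Lemma continuous_borel_measurable f : continuous f ->
  measurable_fun [set: borel_type X] (f : borel_type X -> R).
Proof.
move=> cf; apply: (measurability _ (RGenOpens.measurableE R)).
move=> _ [_ [a [b ->] <-]]; rewrite setTI.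
apply: sub_sigma_algebra; apply: open_comp; first by move=> + _; exact: cf.
exact: interval_open.
Qed.

Lemma open_borel_measurable (O : set X) : open O ->
  measurable (O : set (borel_type X)).
Proof. by move=> oO; exact: sub_sigma_algebra. Qed.

Lemma closed_borel_measurable (F : set X) : closed F ->
  measurable (F : set (borel_type X)).
Proof.
move=> cF; rewrite -(setCK F); apply: measurableC.
by apply: open_borel_measurable; exact: closed_openC.
Qed.

End C0_functions.

(** * Urysohn functions vanishing at infinity *)

Section urysohn.
Context {R : realType} {X : ptopologicalType}.
Hypotheses (lcX : locally_compact [set: X]) (hausX : hausdorff_space X).

(** Complete regularity yields a function that is merely continuous. Separating [x] from the
    complement of [O] intersected with the interior of a compact neighbourhood [V] forces [1 - f] to
    vanish outside [V], hence at infinity. *)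
Let urysohn_point (x : X) (O : set X) : open O -> O x ->
  exists u : X -> R, [/\ C0 u, forall y, 0 <= u y <= 1, u x = 1 &
    forall y, ~ O y -> u y = 0].
Proof.
move=> oO Ox; have [V] := lcX I (x := x); rewrite withinET => Vx [cV clV].
have oW : open (O `&` interior V) by apply: openI => //; exact: open_interior.
have Wx : (O `&` interior V) x by [].
have : uniform_separator [set x] (~` (O `&` interior V)).
  apply: (locally_compact_completely_regular (R := R)) => //.
  exact: open_closedC.
move=> /(@uniform_separatorP _ R)[f [cf f01 fx fW]].
have W0 y : ~ (O `&` interior V) y -> f y = 1.
  by move=> nWy; apply: fW; exists y.
have {}f01 y : 0 <= f y <= 1.
  by have := f01 (f y) (ex_intro2 _ _ y I erefl); rewrite /= in_itv.
exists (fun y => 1 - f y); split.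
- have c1f : continuous (fun y => 1 - f y).
    by move=> y; apply: cvgB; [exact: cvg_cst|exact: cf].
  split => // eps eps0; apply: (subclosed_compact _ cV).
    exact/closed_level/continuous_abs.
  move=> y /= ey; have [/W0 fy1|/contrapT[_ /interior_subset//]] :=
    pselect (~ (O `&` interior V) y).
  by move: ey; rewrite fy1 subrr normr0 leNgt eps0.
- by move=> y; have := f01 y; lra.
- by rewrite (_ : f x = 0) ?subr0//; apply: fx; exists x.
- by move=> y nOy; rewrite W0 ?subrr// => -[].
Qed.

(** By compactness, finitely many sets where a point function exceeds 1/2 cover [K]. The sum of the
    doubled functions is then at least 1 on [K], and truncation at 1 keeps it in [C0] by
    domination. *)
Lemma C0_urysohn (K O : set X) : compact K -> open O -> K `<=` O ->
  exists u : X -> R, [/\ C0 u, forall y, 0 <= u y <= 1,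
    forall y, K y -> u y = 1 & forall y, ~ O y -> u y = 0].
Proof.
move=> cK oO KO.
have /choice[v vP] (x : X) : exists u : X -> R, O x ->
    [/\ C0 u, forall y, 0 <= u y <= 1, u x = 1 & forall y, ~ O y -> u y = 0].
  have [Ox|nOx] := pselect (O x); last by exists (fun=> 0).
  by have [u uP] := urysohn_point oO Ox; exists u.
have /(_ X K (fun x => [set y | 2^-1 < v x y])) : cover_compact K.
  by rewrite -compact_cover.
case.
- move=> x Kx; have [[cv _] _ _ _] := vP _ (KO _ Kx).
  apply: (@open_comp _ _ (v x) [set t | 2^-1 < t]); last exact: open_gt.
  by move=> y _; exact: cv.
- move=> x Kx; exists x => //=; have [_ _ -> _] := vP _ (KO _ Kx).
  by rewrite invf_lt1// ltr1n.
move=> D DK Kcov.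
have DO (x : X) : x \in D -> O x by move=> /DK/set_mem/KO.
(* [v x] is arbitrary for [x] outside [O]. Setting [w x] to 0 for [x] outside [D] makes positivity
   and membership in [C0] hold for every index. *)
pose w (x y : X) := if x \in D then 2 * v x y else 0.
have w0 x y : 0 <= w x y.
  rewrite /w; case: ifPn => // /DO /vP[_ /(_ y) /andP[vy _] _ _].
  by rewrite mulr_ge0.
have Cw x : C0 (w x).
  have [xD|xD] := boolP (x \in D); last first.
    rewrite (_ : w x = fun=> 0); first exact: C0_zero.
    by apply/funext => y; rewrite /w (negbTE xD).
  have [Cv _ _ _] := vP _ (DO _ xD).
  rewrite (_ : w x = fun y => 2 * v x y); first exact: C0_scale.
  by apply/funext => y; rewrite /w xD.
pose s y := \sum_(x <- D) w x y.
have s0 y : 0 <= s y by exact: sumr_ge0.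
have Cs : C0 s by exact: C0_sum.
exists (fun y => Num.min (s y) 1); split.
- apply: (@C0_dominated _ _ s _ 1) => //.
    by move=> y; apply: (@continuous_min R X s (cst 1)); [exact: Cs.1|exact: cvg_cst].
  move=> y; rewrite mul1r !ger0_norm ?le_min ?s0 ?ler01//.
  by rewrite ge_min lexx.
- by move=> y; rewrite le_min s0 ge_min lexx orbT ler01.
- move=> y /Kcov[x /= xD vxy]; apply/min_idPr.
  rewrite /s (bigD1_seq x) ?fset_uniq//= {1}/w xD.
  by rewrite ler_wpDr ?sumr_ge0//; move: vxy; lra.
- move=> y nOy; rewrite /s big1 ?min_l// => x _.
  by rewrite /w; case: ifPn => // /DO /vP[_ _ _ ->]//; rewrite mulr0.
Qed.

End urysohn.

(** * Integrals of [C0] functions against finite measures *)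

Section finite_measure_integral.
Context {R : realType} {X : ptopologicalType}.
Variable m : {finite_measure set (borel_type X) -> \bar R}.
Implicit Types f g : X -> R.

Lemma C0_integrable f : C0 f ->
  m.-integrable [set: borel_type X] (EFin \o (f : borel_type X -> R)).
Proof.
move=> Cf; apply: measurable_bounded_integrable => //.
- by rewrite -ge0_fin_numE// fin_num_measure.
- exact: continuous_borel_measurable Cf.1.
- have [M fM] := C0_bounded Cf; exists M; split; first exact: num_real.
  by move=> N /ltW MN x _; exact: le_trans MN.
Qed.

Lemma Rintegral_C0_lin (a : R) f g : C0 f -> C0 g ->
  Rintegral m setT (fun x => a * f x + g x) =
  a * Rintegral m setT f + Rintegral m setT g.
Proof.
move=> Cf Cg; have [If Ig] := (C0_integrable Cf, C0_integrable Cg).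
have Iaf := C0_integrable (C0_scale a Cf).
have -> := RintegralD measurableT Iaf Ig.
by have -> := RintegralZl a measurableT If.
Qed.

Lemma Rintegral_C0_sum (J : Type) (s : seq J) (c : J -> R) (u : J -> X -> R) :
  (forall j, C0 (u j)) ->
  Rintegral m setT (fun x => \sum_(j <- s) c j * u j x) =
  \sum_(j <- s) c j * Rintegral m setT (u j).
Proof.
move=> Cu; elim: s => [|j s ih].
  rewrite big_nil (_ : (fun x => _) = fun=> 0) ?Rintegral_cst ?mul0r//.
  by apply/funext => x; rewrite big_nil.
rewrite big_cons -ih -Rintegral_C0_lin//; last first.
  by apply: (@C0_sum _ _ _ _ _ (fun j x => c j * u j x)) => i; exact: C0_scale.
by congr Rintegral; apply/funext => x; rewrite big_cons.
Qed.

Lemma Rintegral_sup_bound (c : R) f : C0 f -> (forall x, `|f x| <= c) ->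
  `|Rintegral m setT f| <= c * fine (m setT).
Proof.
move=> Cf fc; have If := C0_integrable Cf.
apply: (le_trans (le_normr_Rintegral measurableT If)).
rewrite -(Rintegral_cst m measurableT c); apply: le_Rintegral => //.
- exact/integrable_norm.
- exact: finite_measure_integrable_cst.
Qed.

Lemma Rintegral_indic (A : set (borel_type X)) : measurable A ->
  m.-integrable setT (EFin \o (\1_A : borel_type X -> R)) /\
  Rintegral m setT \1_A = fine (m A).
Proof.
move=> mA; split; last by rewrite /Rintegral integral_indic ?setIT.
exact: integrable_indic.
Qed.

Lemma Rintegral_ge_measure g (A : set (borel_type X)) : measurable A ->
  C0 g -> (forall x, 0 <= g x) -> (forall x, A x -> 1 <= g x) ->
  fine (m A) <= Rintegral m setT g.
Proof.
move=> mA Cg g0 gA; have [iA <-] := Rintegral_indic mA.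
apply: le_Rintegral => //; first exact: C0_integrable.
by move=> x _; have [/set_mem/gA//|_] := boolP (x \in A).
Qed.

Lemma Rintegral_le_measure g (A : set (borel_type X)) : measurable A ->
  C0 g -> (forall x, g x <= 1) -> (forall x, ~ A x -> g x <= 0) ->
  Rintegral m setT g <= fine (m A).
Proof.
move=> mA Cg g1 gA; have [iA <-] := Rintegral_indic mA.
apply: le_Rintegral => //; first exact: C0_integrable.
move=> x _; have [//|xA] := boolP (x \in A).
by apply: gA => Ax; move: xA; rewrite mem_set.
Qed.

End finite_measure_integral.

(** * Riesz-Markov representation *)

Lemma le_harmonic {R : archiRealFieldType} (x C : R) :
  (forall n, x <= C / n.+1%:R) -> x <= 0.
Proof.
move=> xC; rewrite leNgt; apply/negP => x0.
have := xC (Num.trunc (C / x)); rewrite ler_pdivlMr ?ltr0n// mulrC.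
by rewrite -ler_pdivlMr// leNgt truncnS_gt.
Qed.

Section positive_functionals.
Context {R : realType} {X : ptopologicalType}.

Definition C0pos : set (X -> R) := [set f | C0 f /\ forall x, 0 <= f x].

Lemma C0pos_add f g : C0pos f -> C0pos g -> C0pos (fun x => f x + g x).
Proof.
move=> [Cf f0] [Cg g0]; split; first exact: C0_add.
by move=> x; rewrite addr_ge0.
Qed.

Lemma C0pos_sub f g : C0 f -> C0 g -> (forall x, f x <= g x) ->
  C0pos (fun x => g x - f x).
Proof. by move=> Cf Cg fg; split; [exact: C0_sub|move=> x; rewrite subr_ge0]. Qed.

Lemma C0pos_scale (a : R) f : 0 <= a -> C0pos f -> C0pos (fun x => a * f x).
Proof.
by move=> a0 [Cf f0]; split; [exact: C0_scale|move=> x; rewrite mulr_ge0].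
Qed.

Lemma C0pos_minf f (g : X -> R) : C0pos f -> continuous g -> (forall x, 0 <= g x) ->
  C0pos (fun x => Num.min (f x) (g x)).
Proof.
move=> [Cf f0] cg g0; split; last by move=> x; rewrite le_min f0 g0.
apply: (@C0_dominated _ _ f _ 1) => //.
  by move=> x; apply: (@continuous_min R X f g); [exact: Cf.1|exact: cg].
by move=> x; rewrite mul1r !ger0_norm ?le_min ?f0 ?g0// ge_min lexx.
Qed.

Lemma C0pos_min f (c : R) : 0 <= c -> C0pos f -> C0pos (fun x => Num.min (f x) c).
Proof. by move=> c0 pf; apply: C0pos_minf => //; exact: cst_continuous. Qed.

(** Homogeneity is left out: additivity gives it for natural multiples, and the slicing argument
    uses no others. *)
Definition additive_C0pos (L : (X -> R) -> R) : Prop :=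
  [/\ forall f, C0pos f -> 0 <= L f &
      forall f g, C0pos f -> C0pos g -> L (fun x => f x + g x) = L f + L g].

Section additive_functionals.
Variable L : (X -> R) -> R.
Hypothesis Ladd : additive_C0pos L.

Lemma additive_C0pos_le f g : C0pos f -> C0pos g -> (forall x, f x <= g x) ->
  L f <= L g.
Proof.
move=> pf pg fg; have ph := C0pos_sub pf.1 pg.1 fg.
rewrite (_ : g = fun x => f x + (g x - f x)); last first.
  by apply/funext => x; rewrite addrC subrK.
by rewrite Ladd.2// lerDl; exact: Ladd.1.
Qed.

Lemma C0pos_zero : C0pos (fun=> 0).
Proof. by split => //; exact: C0_zero. Qed.

Lemma additive_C0pos0 : L (fun=> 0) = 0.
Proof.
have := Ladd.2 _ _ C0pos_zero C0pos_zero.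
rewrite (_ : (fun x : X => (0 : R) + 0) = fun=> 0); first by lra.
by apply/funext => x; rewrite addr0.
Qed.

Lemma additive_C0posMn f n : C0pos f -> L (fun x => n%:R * f x) = n%:R * L f.
Proof.
move=> pf; elim: n => [|n ih].
  rewrite mul0r (_ : (fun x => _) = fun=> 0) ?additive_C0pos0//.
  by apply/funext => x; rewrite mul0r.
rewrite (_ : (fun x => _) = fun x => n%:R * f x + f x); last first.
  by apply/funext => x; rewrite -natr1 mulrDl mul1r.
by rewrite Ladd.2//; [rewrite ih -natr1 mulrDl mul1r|exact: C0pos_scale].
Qed.

(* [f] is the sum of the [n.+1] slices [min f ((j+1)h) - min f (jh)] with
   [h = 1/(n+1)], and [n.+1] times a slice lies between the indicators of
   [f > (j+1)h] and [f > jh]. *)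
Lemma additive_C0pos_layers (lam : set X -> R) f n :
  (forall g O1 O2, C0pos g -> open O1 -> open O2 -> (forall x, g x <= 1) ->
    (forall x, ~ O1 x -> g x = 0) -> (forall x, O2 x -> g x = 1) ->
    lam O2 <= L g <= lam O1) ->
  C0pos f -> (forall x, f x <= 1) ->
  \sum_(j < n.+1) lam [set x | j.+1%:R / n.+1%:R < f x] <= n.+1%:R * L f <=
  \sum_(j < n.+1) lam [set x | j%:R / n.+1%:R < f x].
Proof.
move=> Llam pf f1; pose h : R := n.+1%:R^-1.
have h0 : 0 < h by rewrite invr_gt0.
have nh : n.+1%:R * h = 1 by rewrite mulfV.
pose t j x := Num.min (f x) (j%:R * h).
have pt j : C0pos (t j) by apply: C0pos_min => //; rewrite mulr_ge0// ltW.
have t_le j x : t j x <= t j.+1 x.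
  by rewrite /t le_min !ge_min lexx/= -natr1 mulrDl mul1r lerDl (ltW h0) !orbT.
pose s j x := n.+1%:R * (t j.+1 x - t j x).
have ptt j : C0pos (fun x => t j.+1 x - t j x).
  exact: C0pos_sub (pt _).1 (pt _).1 (t_le _).
have Lsum m : \sum_(j < m) L (s j) = n.+1%:R * L (t m).
  elim: m => [|m ih].
    rewrite big_ord0 (_ : t 0 = fun=> 0) ?additive_C0pos0 ?mulr0//.
    by apply/funext => x; rewrite /t mul0r; apply/min_idPr; exact: pf.2.
  rewrite big_ord_recr/= ih additive_C0posMn// -mulrDr -Ladd.2//; congr (_ * L _).
  by apply/funext => x; rewrite addrC subrK.
have tf : t n.+1 = f.
  by apply/funext => x; rewrite /t nh; apply/min_idPl.
have of_ c : open [set x | c < f x].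
  apply: (@open_comp _ _ f [set y | c < y]); last exact: open_gt.
  by move=> x _; exact: pf.1.1.
have sj j : lam [set x | j.+1%:R / n.+1%:R < f x] <= L (s j) <=
    lam [set x | j%:R / n.+1%:R < f x].
  apply: Llam => //.
  - exact: C0pos_scale.
  - move=> x; rewrite /s -[leRHS]nh ler_pM2l ?ltr0n// /t.
    rewrite -natr1 mulrDl mul1r.
    by rewrite /Num.min; do 2 case: ifPn; rewrite -?leNgt => *; lra.
  - move=> x /negP; rewrite -leNgt -/h => fx.
    rewrite /s /t !min_l ?subrr ?mulr0//.
    by rewrite (le_trans fx)// ler_pM2r// ler_nat.
  - move=> x /=; rewrite -/h => fx.
    rewrite /s /t !min_r ?(ltW fx)//; first by rewrite -mulrBl -natrB// subSnn mul1r.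
    by rewrite (le_trans _ (ltW fx))// ler_pM2r// ler_nat.
have := Lsum n.+1; rewrite tf => <-.
by apply/andP; split; apply: ler_sum => j _; have /andP[] := sj j.
Qed.

End additive_functionals.

(** For [f <= 1] the numbers [n.+1 * L1 f] and [n.+1 * L2 f] lie between the same two layer sums.
    These sums telescope against each other to [lam {f > 0} - lam {f > 1}], at most [C], so [L1 f]
    and [L2 f] differ by at most [C / n.+1] for every [n]. *)
Lemma additive_C0pos_eq (L1 L2 : (X -> R) -> R) (lam : set X -> R) (C : R) :
  additive_C0pos L1 -> additive_C0pos L2 ->
  (forall O, open O -> 0 <= lam O <= C) ->
  (forall L, L = L1 \/ L = L2 ->
    forall g O1 O2, C0pos g -> open O1 -> open O2 -> (forall x, g x <= 1) ->
    (forall x, ~ O1 x -> g x = 0) -> (forall x, O2 x -> g x = 1) ->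
    lam O2 <= L g <= lam O1) ->
  forall f, C0pos f -> L1 f = L2 f.
Proof.
move=> A1 A2 lamC Llam f pf.
(* The scaling factor is an integer because additivity controls integer multiples. *)
wlog f1 : f pf / forall x, f x <= 1.
  move=> H; have [M fM] := C0_bounded pf.1.
  pose N := (Num.trunc M).+1.
  have MN : M <= N%:R by rewrite ltW// truncnS_gt.
  have N0 : 0 < N%:R :> R by rewrite ltr0n.
  have pNf : C0pos (fun x => N%:R^-1 * f x).
    by apply: C0pos_scale => //; rewrite invr_ge0.
  have fE : f = fun x => N%:R * (N%:R^-1 * f x).
    by apply/funext => x; rewrite mulVKf// gt_eqF.
  rewrite fE !additive_C0posMn//; congr (_ * _); apply: H => // x.
  by rewrite mulrC ler_pdivrMr// mul1r (le_trans (ler_norm _))// (le_trans (fM _)).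
have of_ c : open [set x | c < f x].
  apply: (@open_comp _ _ f [set y | c < y]); last exact: open_gt.
  by move=> x _; exact: pf.1.1.
apply/eqP; rewrite -subr_eq0 -normr_le0; apply: (le_harmonic (C := C)) => n.
have B1 := additive_C0pos_layers A1 n (Llam _ (or_introl erefl)) pf f1.
have B2 := additive_C0pos_layers A2 n (Llam _ (or_intror erefl)) pf f1.
pose a j := lam [set x | j%:R / n.+1%:R < f x].
have /andP[a0 aC] : 0 <= a 0 <= C by exact/lamC/of_.
have /andP[b0 bC] : 0 <= a n.+1 <= C by exact/lamC/of_.
have E1 : \sum_(j < n.+1) a j = a 0 + \sum_(j < n) a j.+1 by rewrite big_ord_recl.
have E2 : \sum_(j < n.+1) a j.+1 = \sum_(j < n) a j.+1 + a n.+1.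
  by rewrite big_ord_recr.
rewrite ler_pdivlMr ?ltr0n// mulrC -(ger0_norm (ler0n R n.+1)) -normrM mulrBr.
rewrite ler_norml; move: B1 B2; rewrite -/(a _) E1 E2.
move: (n.+1%:R * L1 f) (n.+1%:R * L2 f) => x y; lra.
Qed.

End positive_functionals.

(** * Construction of the representing measure *)

Section riesz_markov.
Context {R : realType} {X : ptopologicalType}.
Hypotheses (lcX : locally_compact [set: X]) (hausX : hausdorff_space X).
Variables (L : (X -> R) -> R) (C : R).
Hypotheses (Ladd : additive_C0pos L)
  (LC : forall f, C0pos f -> (forall x, f x <= 1) -> L f <= C).

(** This is [(f - d)^+]. It vanishes wherever [f <= d], so for [d > 0] and [f] in [C0pos] it is
    carried by the compact set where [d <= f]. *)
Definition C0cut (d : R) (f : X -> R) x := f x - Num.min (f x) d.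

Lemma C0pos_cut d f : 0 <= d -> C0pos f -> C0pos (C0cut d f).
Proof.
move=> d0 pf; apply: C0pos_sub => //; first exact: (C0pos_min d0 pf).1.
  exact: pf.1.
by move=> x; rewrite ge_min lexx.
Qed.

Lemma C0cut_le d f x : 0 <= d -> 0 <= f x -> C0cut d f x <= f x.
Proof. by move=> d0 f0; rewrite /C0cut gerBl le_min f0. Qed.

Lemma C0cut_eq0 d f x : f x <= d -> C0cut d f x = 0.
Proof. by move=> fd; rewrite /C0cut min_l// subrr. Qed.

(** The part cut away is [min f d]. With [d = 1/(n+1)] its multiple by [n+1] is at most 1, so its
    value under [L] is at most [C/(n+1)], which is below [e] for the chosen [n]. The level [d] does
    not depend on [f]. *)
Let L_cut (e : R) : 0 < e -> exists2 d, 0 < d &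
  forall f, C0pos f -> L f <= L (C0cut d f) + e.
Proof.
move=> e0; pose n := Num.trunc (C / e); exists n.+1%:R^-1 => [|f pf].
  by rewrite invr_gt0.
have n0 : 0 <= n.+1%:R^-1 :> R by rewrite invr_ge0.
have pm := C0pos_min n0 pf.
rewrite {1}(_ : f = fun x => C0cut n.+1%:R^-1 f x +
    Num.min (f x) n.+1%:R^-1); last first.
  by apply/funext => x; rewrite subrK.
rewrite Ladd.2 ?lerD2l//; last exact: C0pos_cut.
rewrite -(ler_pM2l (ltr0Sn R n)) -additive_C0posMn// (@le_trans _ _ C)//.
  apply: LC => [|x]; first exact: C0pos_scale.
  by rewrite -ler_pdivlMl// mulr1 ge_min lexx orbT.
by rewrite -ler_pdivrMr// ltW// truncnS_gt.
Qed.

Definition C0below (O : set X) : set (X -> R) :=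
  [set f | [/\ C0pos f, forall x, f x <= 1 & forall x, ~ O x -> f x = 0]].

(** The future measure of the open set [O]. The competitors vanish outside [O] without having
    compact support in it; [L_cut] compensates for this. *)
Definition open_weight (O : set X) : R := sup [set L f | f in C0below O].

Local Notation lam := open_weight.

Let below0 O : C0below O (fun=> 0).
Proof. by split => //; exact: C0pos_zero. Qed.

Let lam_ge O f : C0below O f -> L f <= lam O.
Proof.
move=> Of; apply: ub_le_sup; last by exists f.
by exists C => _ [g [pg g1 _] <-]; exact: LC.
Qed.

Let lam_le O r : (forall f, C0below O f -> L f <= r) -> lam O <= r.
Proof.
move=> H; apply: ge_sup; first by exists (L (fun=> 0)), (fun=> 0).
by move=> _ [f Of <-]; exact: H.
Qed.

Let lam_ge0 O : 0 <= lam O.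
Proof. by rewrite -(additive_C0pos0 Ladd); exact: lam_ge. Qed.

Let lam_leC O : lam O <= C.
Proof. by apply: lam_le => f [pf f1 _]; exact: LC. Qed.

Let lam_mono O U : O `<=` U -> lam O <= lam U.
Proof.
move=> OU; apply: lam_le => f [pf f1 f0]; apply: lam_ge; split => // x nUx.
by apply: f0 => /OU.
Qed.

Let lam0 : lam set0 = 0.
Proof.
apply/eqP; rewrite eq_le lam_ge0 andbT; apply: lam_le => f [_ _ f0].
rewrite (_ : f = fun=> 0) ?(additive_C0pos0 Ladd)//.
by apply/funext => x; exact: f0.
Qed.

(** After cutting [f] at [d], the part [K] minus [U] of the level set is compact and contained in
    [O]. A Urysohn function [u] for this pair splits the cut function [c] into [c * u], which
    vanishes off [O], and [c - c * u], which vanishes off [U]. *)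
Let lamU O U : open O -> open U -> lam (O `|` U) <= lam O + lam U.
Proof.
move=> oO oU; apply: lam_le => f [pf f1 f0]; apply/ler_addgt0Pr => e e0.
have [d d0 Ld] := L_cut e0.
pose K := [set x | d <= `|f x|].
have cK : compact (K `\` U).
  apply: (@subclosed_compact _ _ K); last by move=> x [].
    apply: closedI; last exact: open_closedC.
    exact/closed_level/continuous_abs/pf.1.1.
  exact: pf.1.2.
have KO : K `\` U `<=` O.
  move=> x []; rewrite {1}/K /= => dx nUx; apply: contrapT => nOx.
  by move: dx; rewrite f0 ?normr0 ?leNgt ?d0// => -[].
have [u [Cu u01 uK uO]] := C0_urysohn (R := R) lcX hausX cK oO KO.
have pc := C0pos_cut (ltW d0) pf.
have cut1 x : C0cut d f x <= 1.
  by rewrite (le_trans (C0cut_le (ltW d0) (pf.2 x))).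
have puc : C0pos (fun x => C0cut d f x * u x).
  split; last by move=> x; rewrite mulr_ge0 ?pc.2//; have /andP[] := u01 x.
  apply: (@C0_dominated _ _ u _ 1) => //.
    by move=> x; apply: cvgM; [exact: pc.1.1|exact: Cu.1].
  by move=> x; rewrite normrM ler_wpM2r// ger0_norm ?pc.2.
have pvc : C0pos (fun x => C0cut d f x - C0cut d f x * u x).
  apply: C0pos_sub; [exact: puc.1|exact: pc.1|move=> x].
  by rewrite ler_piMr ?pc.2//; have /andP[] := u01 x.
rewrite (le_trans (Ld _ pf))// lerD2r.
rewrite (_ : C0cut d f = fun x => C0cut d f x * u x +
    (C0cut d f x - C0cut d f x * u x)); last first.
  by apply/funext => x; rewrite addrC subrK.
rewrite Ladd.2//; apply: lerD; apply: lam_ge; split => // x.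
- by have /andP[u0 u1] := u01 x; rewrite mulr_ile1// pc.2.
- by move=> nOx; rewrite uO ?mulr0.
- by rewrite (le_trans _ (cut1 x))// gerBl puc.2.
- move=> nUx; have [dx|dx] := leP d (f x).
    by rewrite uK ?mulr1 ?subrr//; split => //; rewrite /K /= ger0_norm ?pf.2.
  by rewrite C0cut_eq0 ?mul0r ?subrr// ltW.
Qed.

(** The level set where [d <= |f|] is compact, hence covered by finitely many of the [F i]; the cut
    function is then a competitor for a finite union. Bounding all partial sums by [r] avoids
    speaking of convergence of the series. *)
Let lam_bigcup (F : nat -> set X) r : (forall i, open (F i)) ->
  (forall n, \sum_(i < n) lam (F i) <= r) -> lam (\bigcup_i F i) <= r.
Proof.
move=> oF Fr; apply: lam_le => f [pf f1 f0]; apply/ler_addgt0Pr => e e0.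
have [d d0 Ld] := L_cut e0.
have : cover_compact [set x | d <= `|f x|].
  by rewrite -compact_cover; exact: pf.1.2.
move=> /(_ _ setT F)[//|x /= dx|D _ Dcov].
  apply: contrapT => nFx. move: dx; rewrite f0 ?normr0 ?leNgt ?d0//.
pose n := (\max_(i <- D) i).+1.
have Dn (x : X) : d < f x -> exists2 i, (i < n)%N & F i x.
  move=> dx; have /Dcov[i /= iD Fix] : d <= `|f x| by rewrite ger0_norm ?pf.2 ?ltW.
  by exists i => //; rewrite ltnS; exact: leq_bigmax_seq.
rewrite (le_trans (Ld _ pf))// lerD2r (le_trans _ (Fr n))//.
apply: (@le_trans _ _ (lam (\big[setU/set0]_(i < n) F i))); last first.
  elim: n {Dn} => [|n ih]; first by rewrite !big_ord0 lam0.
  rewrite !big_ord_recr/= (le_trans (lamU _ (oF n))) ?lerD2r//.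
  by rewrite -bigcup_mkord; apply: bigcup_open.
have pc := C0pos_cut (ltW d0) pf.
apply: lam_ge; split => // [x|x nFx].
  by rewrite (le_trans (C0cut_le (ltW d0) (pf.2 x))).
apply: C0cut_eq0; rewrite leNgt; apply/negP => /Dn[i ni Fix]; apply: nFx.
by rewrite -bigcup_mkord; exists i.
Qed.

Definition riesz_content (A : set X) : R :=
  inf [set lam O | O in [set O | open O /\ A `<=` O]].

Local Notation mu := riesz_content.

Let mu_has_inf A : has_inf [set lam O | O in [set O | open O /\ A `<=` O]].
Proof.
split; first by exists (lam setT), setT => //; split => //; exact: openT.
by exists 0 => _ [U _ <-].
Qed.

Let mu_le A O : open O -> A `<=` O -> mu A <= lam O.
Proof. by move=> oO AO; apply: ge_inf; [exact: (mu_has_inf A).2|exists O]. Qed.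

Let mu_ge A r : (forall O, open O -> A `<=` O -> r <= lam O) -> r <= mu A.
Proof.
move=> H; apply: lb_le_inf; first exact: (mu_has_inf A).1.
by move=> _ [U [oU AU] <-]; exact: H.
Qed.

Let mu_adherent A e : 0 < e -> exists O, [/\ open O, A `<=` O & lam O < mu A + e].
Proof.
by move=> e0; have [_ [U [oU AU] <-] lt] := inf_adherent e0 (mu_has_inf A); exists U.
Qed.

Let mu_open O : open O -> mu O = lam O.
Proof.
move=> oO; apply/eqP; rewrite eq_le mu_le//=.
by apply: mu_ge => U oU; exact: lam_mono.
Qed.

Let mu_ge0 A : 0 <= mu A.
Proof. by apply: mu_ge => O _ _; exact: lam_ge0. Qed.

Let mu_mono A B : A `<=` B -> mu A <= mu B.
Proof.
by move=> AB; apply: mu_ge => O oO BO; apply: mu_le => //; exact: subset_trans BO.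
Qed.

Definition riesz_outer (A : set X) : \bar R := (mu A)%:E.

Let outer0 : riesz_outer set0 = 0%E.
Proof. by rewrite /riesz_outer mu_open ?lam0//; exact: open0. Qed.

Let outer_ge0 A : (0 <= riesz_outer A)%E.
Proof. by rewrite lee_fin. Qed.

Let outer_mono : {homo riesz_outer : A B / A `<=` B >-> (A <= B)%E}.
Proof. by move=> A B AB; rewrite lee_fin; exact: mu_mono. Qed.

Let outer_sigma_subadditive : sigma_subadditive riesz_outer.
Proof.
move=> F; have : (0 <= \sum_(i <oo) riesz_outer (F i))%E.
  by apply: nneseries_ge0 => i _ _; exact: outer_ge0.
case E : (\sum_(i <oo) riesz_outer (F i))%E => [s| |]// _; last by rewrite leey.
rewrite lee_fin.
have psum n : \sum_(i < n) mu (F i) <= s.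
  rewrite -lee_fin -E -sumEFin.
  rewrite -(big_mkord xpredT (fun i => riesz_outer (F i))).
  by apply: nneseries_lim_ge => i _ _; exact: outer_ge0.
apply/ler_addgt0Pr => e e0.
(* The errors [e / 2 ^+ i.+1] add up to less than [e]. *)
have /choice[U UP] i : exists U, [/\ open U, F i `<=` U &
    lam U < mu (F i) + e / 2 ^+ i.+1].
  by apply: mu_adherent; rewrite divr_gt0// exprn_gt0.
apply: (@le_trans _ _ (lam (\bigcup_i U i))).
  apply: mu_le; first by apply: bigcup_open => i _; have [] := UP i.
  by apply: subset_bigcup => i _; have [] := UP i.
apply: lam_bigcup => [i|n]; first by have [] := UP i.
apply: (@le_trans _ _ (\sum_(i < n) (mu (F i) + e / 2 ^+ i.+1))).
  by apply: ler_sum => i _; have [_ _ /ltW] := UP i.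
rewrite big_split/=; apply: lerD; first exact: psum.
have -> : \sum_(i < n) e / 2 ^+ i.+1 = e - e / 2 ^+ n.
  elim: n => [|n ih]; first by rewrite big_ord0 expr0 divr1 subrr.
  rewrite big_ord_recr/= ih exprS invfM.
  by move: (2 ^+ n)^-1 => y; field.
by rewrite gerBl divr_ge0 ?ltW// exprn_gt0.
Qed.

HB.instance Definition _ := isOuterMeasure.Build R X riesz_outer
  outer0 outer_ge0 outer_mono outer_sigma_subadditive.

(** Let [U] be an open set containing [Y], [f] a competitor for the intersection of [U] and [O], and
    [F] the closed set where [d <= f]. Since [f] vanishes off [O], the part of [U] outside [O] lies
    in [U] minus [F]. If [g] is a competitor for the latter, then [C0cut d f] and [g] are never both
    non-zero, so their sum is a competitor for [U]. *)
Let open_caratheodory O : open O -> riesz_outer.-caratheodory O.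
Proof.
move=> oO; apply: le_caratheodory_measurable => Y; rewrite -EFinD lee_fin.
apply: mu_ge => U oU YU.
have oOU : open (U `&` O) by exact: openI.
apply: (@le_trans _ _ (lam (U `&` O) + mu (U `&` ~` O))).
  by apply: lerD; [apply: mu_le => //|apply: mu_mono]; exact: setSI.
rewrite -lerBrDr; apply: lam_le => f [pf f1 f0]; rewrite lerBrDr.
apply/ler_addgt0Pr => e e0.
have [d d0 Ld] := L_cut e0.
pose F := [set x | d <= f x].
have clF : closed F by exact/closed_level/pf.1.1.
apply: (@le_trans _ _ (L (C0cut d f) + e + lam (U `&` ~` F))).
  apply: lerD; first exact: Ld.
  apply: mu_le; first by apply: openI => //; exact: closed_openC.
  move=> x [Ux nOx]; split => //; rewrite /F /= => dx; move: dx.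
  by rewrite f0 ?leNgt ?d0// => -[].
rewrite addrAC lerD2r -lerBrDl; apply: lam_le => g [pg g1 g0].
rewrite lerBrDl.
have pc := C0pos_cut (ltW d0) pf.
have cutF x : ~ F x -> C0cut d f x = 0.
  by move=> /negP; rewrite -ltNge => /ltW; exact: C0cut_eq0.
rewrite -Ladd.2//; apply: lam_ge; split.
- exact: C0pos_add.
- move=> x; have [Fx|nFx] := pselect (F x).
    by rewrite g0 ?addr0 ?(le_trans (C0cut_le (ltW d0) (pf.2 x)))// => -[].
  by rewrite cutF// add0r.
- move=> x nUx; rewrite g0 ?addr0; last by case.
  by apply: C0cut_eq0; rewrite f0 ?ltW// => -[].
Qed.

Let borel_caratheodory (A : set (borel_type X)) : measurable A ->
  riesz_outer.-caratheodory A.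
Proof.
move=> mA; have : <<s @open X >> `<=` riesz_outer.-cara.-measurable.
  apply: smallest_sub; last by move=> O oO; exact: open_caratheodory.
  exact: sigma_algebra_measurable.
by apply.
Qed.

(** The same function as [riesz_outer], retyped on [borel_type X] so that the measure structure is
    attached to the Borel sets and not to the Caratheodory measurable sets. *)
Definition riesz_measure (A : set (borel_type X)) : \bar R := riesz_outer A.

Let riesz_measure_sigma_additive : semi_sigma_additive riesz_measure.
Proof.
move=> F mF tF mUF.
apply: (caratheodory_measure_sigma_additive (mu := riesz_outer)) => //.
- by move=> i; exact: borel_caratheodory.
- exact: borel_caratheodory.
Qed.

HB.instance Definition _ := isMeasure.Build _ (borel_type X) R riesz_measure
  outer0 outer_ge0 riesz_measure_sigma_additive.

Let riesz_measure_fin : fin_num_fun riesz_measure.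
Proof. by []. Qed.

HB.instance Definition _ := @Measure_isFinite.Build _ (borel_type X) R
  riesz_measure riesz_measure_fin.

Let mu_caratheodory A Y : measurable (A : set (borel_type X)) ->
  mu Y = mu (Y `&` A) + mu (Y `&` ~` A).
Proof. by move=> mA; have := borel_caratheodory mA Y; rewrite -EFinD => -[]. Qed.

Let muU A B : mu (A `|` B) <= mu A + mu B.
Proof. by rewrite -lee_fin; exact: (outer_measureU2 riesz_outer). Qed.

Let L_cut_le d f (A : set X) : 0 < d -> C0below setT f -> [set x | d <= f x] `<=` A ->
  L (C0cut d f) <= mu A.
Proof.
move=> d0 [pf f1 _] dA; apply: mu_ge => U oU AU; apply: lam_ge; split.
- by apply: C0pos_cut => //; exact: ltW.
- by move=> x; rewrite (le_trans (C0cut_le (ltW d0) (pf.2 x))).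
- move=> x nUx; apply: C0cut_eq0; rewrite leNgt; apply/negP => /ltW dx.
  exact/nUx/AU/dA.
Qed.

(** If [L f] is within [e / 3] of the total mass, the compact level set [K] of [f] carries all but
    [2 * e / 3] of it. An open [U] containing the complement of [A], with excess below [e / 3],
    meets [A] in mass below [e / 3]. What remains of [K] outside [U] is compact and contained in
    [A]. *)
Let mu_inner A e : measurable (A : set (borel_type X)) -> 0 < e ->
  exists K, [/\ compact K, K `<=` A & mu A <= mu K + e].
Proof.
move=> mA e0; have e3 : 0 < e / 3 by rewrite divr_gt0.
have [_ [f Tf <-] ltf] : exists2 r, [set L f | f in C0below setT] r &
    lam setT - e / 3 < r.
  apply: sup_adherent => //; split; first by exists (L (fun=> 0)), (fun=> 0).
  by exists C => _ [g [pg g1 _] <-]; exact: LC.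
have [d d0 Ld] := L_cut e3.
have [pf _ _] := Tf.
have f_abs x : `|f x| = f x by rewrite ger0_norm// pf.2.
pose K := [set x | d <= f x].
have cK : compact K.
  by have := pf.1.2 d d0; under eq_set do rewrite f_abs.
have clK : closed K by exact/closed_level/pf.1.1.
have [U [oU AU Ult]] := mu_adherent (~` A) e3.
exists (K `&` ~` U); split.
- apply: (@subclosed_compact _ _ K) => //; apply: closedI => //.
  exact: open_closedC.
- by move=> x [_ nUx]; apply: contrapT => /AU.
- have A_sub : A `<=` ((K `&` ~` U) `|` (~` K)) `|` (U `&` A).
    move=> x Ax; have [Ux|nUx] := pselect (U x); first by right.
    by have [Kx|nKx] := pselect (K x); left; [left|right].
  have h1 := le_trans (mu_mono A_sub) (muU _ _).
  have h2 := muU (K `&` ~` U) (~` K).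
  have h3 := mu_caratheodory setT (closed_borel_measurable clK).
  rewrite !setTI (mu_open openT) in h3.
  have h4 := mu_caratheodory U mA.
  rewrite (setIidr AU) (mu_open oU) in h4.
  have h5 := Ld _ pf.
  have h6 : L (C0cut d f) <= mu K by exact: L_cut_le.
  by lra.
Qed.

Lemma riesz_measure_regular : regular_measure riesz_measure.
Proof.
move=> A mA; split; apply/eqP; rewrite eq_le; apply/andP; split.
- apply/lee_addgt0Pr => e e0; have [K [cK KA AK]] := mu_inner mA e0.
  apply: (@le_trans _ _ ((mu K)%:E + e%:E)%E); first by rewrite -EFinD lee_fin.
  by apply: leeD2r; apply: ereal_sup_ubound; exists K.
- by apply: ge_ereal_sup => _ [K [_ KA] <-]; rewrite lee_fin; exact: mu_mono.
- by apply: le_ereal_inf_tmp => _ [U [_ AU] <-]; rewrite lee_fin; exact: mu_mono.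
- apply/lee_addgt0Pr => e e0; have [U [oU AU Ult]] := mu_adherent A e0.
  apply: (@le_trans _ _ (mu U)%:E); first by apply: ereal_inf_lbound; exists U.
  by rewrite -EFinD lee_fin mu_open// ltW.
Qed.

(** [L] and the integral obey the same layer bounds in terms of [open_weight], and these bounds
    determine an additive functional on the cone. *)
Lemma riesz_measure_integral f : C0pos f -> Rintegral riesz_measure setT f = L f.
Proof.
apply: (additive_C0pos_eq (lam := lam) (C := C)) => //.
- split=> [g [Cg g0]|g h [Cg g0] [Ch h0]]; first exact: Rintegral_ge0.
  by rewrite RintegralD//; exact: C0_integrable.
- by move=> O _; rewrite lam_ge0 lam_leC.
move=> T [->|->] g O U pg oO oU g1 gO gU; last first.
  apply/andP; split; last exact: lam_ge.
  apply: lam_le => h [ph h1 h0]; apply: additive_C0pos_le => // x.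
  have [Ux|nUx] := pselect (U x); first by rewrite gU.
  by rewrite h0 ?pg.2.
have [Cg g0] := pg.
rewrite -(mu_open oO) -(mu_open oU).
rewrite -[mu U]/(fine (riesz_measure U)) -[mu O]/(fine (riesz_measure O)).
apply/andP; split.
- apply: Rintegral_ge_measure => //; first exact: open_borel_measurable.
  by move=> x /gU->.
- apply: Rintegral_le_measure => //; first exact: open_borel_measurable.
  by move=> x /gO->.
Qed.

Theorem riesz_markov_C0 :
  exists m : {finite_measure set (borel_type X) -> \bar R},
    regular_measure m /\ forall f, C0pos f -> Rintegral m setT f = L f.
Proof.
exists riesz_measure; split; first exact: riesz_measure_regular.
exact: riesz_measure_integral.
Qed.

End riesz_markov.

(** * Separation by signed measures *)

Section hahn_banach.
Context {R : realType} {V : lmodType R}.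
Variables (D : set V) (p : V -> R).
Hypotheses (D_lin : forall (a : R) x y, D x -> D y -> D (a *: x + y))
  (pZ : forall (a : R) x, 0 <= a -> D x -> p (a *: x) = a * p x)
  (pD : forall x y, D x -> D y -> p (x + y) <= p x + p y).

(** Partial linear functionals are encoded by their graphs, so that extension is inclusion and
    Zorn's lemma applies to sets. Single-valuedness comes from domination: the difference of two
    values at a point is a value at 0, hence at most [p 0 = 0]. The subspace [D] is there because
    [sup_norm] behaves as a norm on [C0] only, not on all functions. *)
Definition dominated_graph (G : set (V * R)) : Prop :=
  [/\ G (0, 0),
      forall (a : R) u v, G u -> G v -> G (a *: u.1 + v.1, a * u.2 + v.2) &
      forall u, G u -> D u.1 /\ u.2 <= p u.1].

Lemma dominated_graphZ G (a : R) u : dominated_graph G -> G u ->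
  G (a *: u.1, a * u.2).
Proof.
by move=> [G00 Glin _] Gu; have := Glin a u _ Gu G00; rewrite /= !addr0.
Qed.

(** An admissible value [c] at [x0] lies above every [v.2 - p (v.1 - x0)] and below every
    [p (u.1 + x0) - u.2]. Subadditivity of [p] puts the first numbers below the second, so the
    supremum of the first is admissible. *)
Lemma dominated_graph_extend G (x0 : V) : dominated_graph G -> D x0 ->
  exists c, dominated_graph [set u | exists2 v, G v &
    exists t, u = (v.1 + t *: x0, v.2 + t * c)].
Proof.
move=> dG Dx0; have [G00 Glin Gp] := dG.
have D0 : D 0 by have [] := Gp _ G00.
have DN x : D x -> D (- x).
  by move=> Dx; have := D_lin (-1) Dx D0; rewrite scaleN1r addr0.
have DD x y : D x -> D y -> D (x + y).
  by move=> Dx; have := @D_lin 1 x y Dx; rewrite scale1r.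
pose S := [set v.2 - p (v.1 - x0) | v in G].
have ubS u : G u -> ubound S (p (u.1 + x0) - u.2).
  move=> Gu _ [v Gv <-]; rewrite lerBlDr addrAC lerBrDr.
  have [_ le] := Gp _ (Glin 1 _ _ Gv Gu); move: le => /=; rewrite mul1r scale1r.
  move=> /le_trans; apply; have [[Du _] [Dv _]] := (Gp _ Gu, Gp _ Gv).
  rewrite (_ : v.1 + u.1 = (u.1 + x0) + (v.1 - x0)); last first.
    by rewrite addrACA subrr addr0 addrC.
  by apply: pD; apply: DD => //; exact: DN.
have S0 : S !=set0 by exists (0 - p (0 - x0)), (0, 0).
exists (sup S).
have leS v : G v -> v.2 - p (v.1 - x0) <= sup S.
  move=> Gv; apply: ub_le_sup; last by exists v.
  by exists (p (0 + x0) - 0); exact: (ubS (0, 0)).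
have geS u : G u -> sup S <= p (u.1 + x0) - u.2.
  by move=> Gu; apply: ge_sup => //; exact: ubS.
split.
- by exists (0, 0) => //; exists 0; rewrite /= scale0r mul0r !addr0.
- move=> a _ _ [u Gu [s ->]] [v Gv [t ->]]; exists (a *: u.1 + v.1, a * u.2 + v.2).
    exact: Glin.
  exists (a * s + t); congr pair => /=; last by ring.
  by rewrite scalerDl scalerDr scalerA addrACA.
- move=> _ [v Gv [t ->]] /=; have [Dv vp] := Gp _ Gv.
  split; first by rewrite addrC; exact: D_lin.
  (* Division by [|t|] reduces the claim to the lower bound on [c] when [t < 0] and to the upper
     bound when [t > 0]. *)
  have [t0|t0|->] := ltgtP t 0; last by rewrite scale0r mul0r !addr0.
  + have Nt : 0 < - t by rewrite oppr_gt0.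
    have Gw := dominated_graphZ (- t)^-1 dG Gv.
    have := leS _ Gw; rewrite /= lerBlDr -(ler_pM2l Nt) mulrDr mulVKf ?gt_eqF//.
    have Dw : D ((- t)^-1 *: v.1 - x0) by apply: DD; [exact: (Gp _ Gw).1|exact: DN].
    rewrite -(pZ (ltW Nt) Dw) scalerBr scalerA divff ?gt_eqF// scale1r scaleNr opprK.
    by lra.
  + have Gw := dominated_graphZ t^-1 dG Gv.
    have := geS _ Gw; rewrite /= lerBrDr -(ler_pM2l t0) mulrDr mulVKf ?gt_eqF//.
    have Dw : D (t^-1 *: v.1 + x0) by apply: DD => //; exact: (Gp _ Gw).1.
    rewrite -(pZ (ltW t0) Dw) scalerDr scalerA divff ?gt_eqF// scale1r.
    by lra.
Qed.

Theorem hahn_banach (G0 : set (V * R)) : dominated_graph G0 ->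
  exists l : V -> R, [/\ forall u, G0 u -> l u.1 = u.2,
    forall (a : R) x y, D x -> D y -> l (a *: x + y) = a * l x + l y &
    forall x, D x -> l x <= p x].
Proof.
move=> dG0; have [G00 _ _] := dG0.
pose P (G : set (V * R)) := G = set0 \/ (dominated_graph G /\ G0 `<=` G).
have [|A [PA Amax]] := @Zorn_bigcup _ P.
  move=> F FP Ftot.
  have [[G FG G_0]|noG] := pselect (exists2 G, F G & G (0, 0)); last first.
    left; apply/seteqP; split => // u [G FG Gu].
    have [G_eq0|[[G_0 _ _] _]] := FP _ FG; first by rewrite G_eq0 in Gu.
    by apply: noG; exists G.
  have dF H u : F H -> H u -> dominated_graph H.
    by move=> FH Hu; have [H0|[]//] := FP _ FH; rewrite H0 in Hu.
  right; split; last first.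
    move=> u G0u; exists G => //.
    by have [GE|[_]] := FP _ FG; [rewrite GE in G_0|apply].
  split; first by exists G.
  - move=> a u v [G1 FG1 G1u] [G2 FG2 G2v].
    have [G12|G21] := Ftot _ _ FG1 FG2.
    + by exists G2 => //; have [_ + _] := dF _ _ FG2 G2v; apply => //; exact: G12.
    + by exists G1 => //; have [_ + _] := dF _ _ FG1 G1u; apply => //; exact: G21.
  - by move=> u [H FH Hu]; have [_ _] := dF _ _ FH Hu; exact.
have [dA G0A] : dominated_graph A /\ G0 `<=` A.
  case: PA => // A0; exfalso; apply: (Amax G0); last by right; split.
  by rewrite A0; split => // /(_ _ G00).
have [A00 Alin Ap] := dA.
have D0 : D 0 by have [] := Ap _ A00.
have A_tot x : D x -> exists y, A (x, y).
  move=> Dx; apply: contrapT => nAx.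
  have [c dA'] := dominated_graph_extend dA Dx.
  apply: (Amax _ _ (or_intror (conj dA' _))).
  - split.
      move=> u Au; exists u => //; exists 0.
      by rewrite scale0r mul0r !addr0; case: u {Au}.
    move=> /(_ (x, c)) H; apply: nAx; exists c; apply: H.
    by exists (0, 0) => //; exists 1; rewrite /= scale1r mul1r !add0r.
  - move=> u G0u; exists u; first exact: G0A.
    by exists 0; rewrite scale0r mul0r !addr0; case: u {G0u}.
have p0 : p 0 = 0 by rewrite -(scaler0 _ 0) pZ// mul0r.
have A_le x y y' : A (x, y) -> A (x, y') -> y <= y'.
  move=> Ay Ay'; have [_ /=] := Ap _ (Alin (-1) _ _ Ay' Ay).
  by rewrite scaleN1r addNr p0 mulN1r addrC subr_le0.
pose l x := xget 0 [set y | A (x, y)].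
have Al x : D x -> A (x, l x).
  move=> Dx; have [y Axy] := A_tot _ Dx.
  exact: (@xgetI _ 0 [set y | A (x, y)] y Axy).
have l_eq x y : A (x, y) -> l x = y.
  move=> Axy; have Alx : A (x, l x) by apply: Al; have [] := Ap _ Axy.
  by apply/eqP; rewrite eq_le (A_le _ _ _ Axy Alx) (A_le _ _ _ Alx Axy).
exists l; split.
- by move=> [x y] /G0A/l_eq.
- by move=> a x y Dx Dy; apply: l_eq; exact: (Alin a _ _ (Al _ Dx) (Al _ Dy)).
- by move=> x /Al/Ap[].
Qed.

End hahn_banach.

Section separation.
Context {R : realType} {X : ptopologicalType}.
Hypotheses (lcX : locally_compact [set: X]) (hausX : hausdorff_space X).

Lemma sup_normZ (a : R) (f : X -> R) : 0 <= a -> C0 f ->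
  sup_norm (fun x => a * f x) = a * sup_norm f.
Proof.
move=> a0 Cf; have Caf := C0_scale a Cf.
apply/eqP; rewrite eq_le; apply/andP; split.
  by apply: sup_norm_ler => x; rewrite normrM ger0_norm// ler_wpM2l// ler_sup_norm.
have [a_gt0|a_le0] := ltP 0 a; last first.
  have -> : a = 0 by apply/eqP; rewrite eq_le a_le0.
  by rewrite mul0r; apply: sup_norm_ge0; have := C0_scale 0 Cf.
rewrite -ler_pdivlMl//; apply: sup_norm_ler => x.
rewrite ler_pdivlMl// (le_trans _ (ler_sup_norm x Caf))//.
by rewrite normrM gtr0_norm.
Qed.

Lemma sup_normD (f g : X -> R) : C0 f -> C0 g ->
  sup_norm (fun x => f x + g x) <= sup_norm f + sup_norm g.
Proof.
move=> Cf Cg; apply: sup_norm_ler => x.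
by rewrite (le_trans (ler_normD _ _))// lerD// ler_sup_norm.
Qed.

Section functional.
Variable L : (X -> R) -> R.
Hypotheses (L_lin : forall a f g, C0 f -> C0 g ->
    L (fun x => a * f x + g x) = a * L f + L g)
  (L_le : forall f, C0 f -> L f <= sup_norm f).

Let LD f g : C0 f -> C0 g -> L (fun x => f x + g x) = L f + L g.
Proof.
move=> Cf Cg; rewrite -[L f]mul1r -L_lin//.
by congr L; apply/funext => x; rewrite mul1r.
Qed.

(** On the cone this is the positive part of [L] in the order dual of [C0]. *)
Definition positive_part (f : X -> R) : R :=
  sup [set L g | g in [set g | C0pos g /\ forall x, g x <= f x]].

Local Notation L1 := positive_part.

Let ub f : C0pos f ->
  ubound [set L g | g in [set g | C0pos g /\ forall x, g x <= f x]] (sup_norm f).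
Proof.
move=> pf _ [g [pg gf] <-]; rewrite (le_trans (L_le pg.1))//.
apply: sup_norm_ler => x; rewrite ger0_norm ?pg.2// (le_trans (gf x))//.
by rewrite (le_trans (ler_norm _))// ler_sup_norm//; exact: pf.1.
Qed.

Let L1_ge f g : C0pos f -> C0pos g -> (forall x, g x <= f x) -> L g <= L1 f.
Proof.
by move=> pf pg gf; apply: ub_le_sup; [exists (sup_norm f); exact: ub|exists g].
Qed.

Let L1_le f r : C0pos f ->
  (forall g, C0pos g -> (forall x, g x <= f x) -> L g <= r) -> L1 f <= r.
Proof.
move=> pf H; apply: ge_sup; first by exists (L f), f.
by move=> _ [g [pg gf] <-]; exact: H.
Qed.

Let L0 : L (fun=> 0) = 0.
Proof.
have := LD C0_zero C0_zero.
by rewrite (_ : (fun x => _) = fun=> 0); [lra|apply/funext => x; rewrite addr0].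
Qed.

(* Additivity is the Riesz decomposition property: if [0 <= h <= f + g] then
   [h = min h f + (h - min h f)] with summands dominated by [f] and [g]. *)
Lemma positive_part_additive : additive_C0pos L1.
Proof.
split=> [f pf|f g pf pg].
  by rewrite -L0; apply: L1_ge => //; [exact: C0pos_zero|exact: pf.2].
have pfg := C0pos_add pf pg.
apply/eqP; rewrite eq_le; apply/andP; split.
  apply: L1_le => // h ph hfg.
  have pm := C0pos_minf ph pf.1.1 pf.2.
  have pd : C0pos (fun x => h x - Num.min (h x) (f x)).
    by apply: C0pos_sub => [||x]; [exact: pm.1|exact: ph.1|rewrite ge_min lexx].
  rewrite (_ : h = fun x => Num.min (h x) (f x) + (h x - Num.min (h x) (f x))).
    rewrite LD; [|exact: pm.1|exact: pd.1].
    apply: lerD; apply: L1_ge => // x; first by rewrite ge_min lexx orbT.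
    rewrite lerBlDr; have [_|_] := leP (h x) (f x); last by rewrite addrC hfg.
    by rewrite lerDr pg.2.
  by apply/funext => x; rewrite addrC subrK.
rewrite -lerBrDr; apply: L1_le => // f' pf' f'f; rewrite lerBrDl -lerBrDr.
apply: L1_le => // g' pg' g'g; rewrite lerBrDr -LD; [|exact: pg'.1|exact: pf'.1].
apply: L1_ge => //; first exact: C0pos_add.
by move=> x; rewrite addrC lerD.
Qed.

(** On the cone, [L] is the difference of the positive additive functionals [L1] and [L1 - L], and
    each of them has a representing measure. Linearity extends the identity to [C0], every [f] being
    the difference of [|f| + f] and [|f|]. *)
Lemma functional_signed_measure :
  exists m1 m2 : {finite_measure set (borel_type X) -> \bar R},
  [/\ regular_measure m1, regular_measure m2 &
      forall f, C0 f -> L f = Rintegral m1 setT f - Rintegral m2 setT f].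
Proof.
have A1 := positive_part_additive.
have B1 f : C0pos f -> (forall x, f x <= 1) -> L1 f <= 1.
  move=> pf f1; apply: L1_le => // g pg gf; rewrite (le_trans (L_le pg.1))//.
  by apply: sup_norm_ler => x; rewrite ger0_norm ?pg.2// (le_trans (gf x)).
pose L2 f := L1 f - L f.
have A2 : additive_C0pos L2.
  split=> [f pf|f g pf pg]; first by rewrite subr_ge0; exact: L1_ge.
  rewrite /L2 A1.2// LD; [|exact: pf.1|exact: pg.1].
  by ring.
(* The constant is 1 + 1: [L1 f <= 1] and [- L f = L (- f) <= 1]. *)
have B2 f : C0pos f -> (forall x, f x <= 1) -> L2 f <= 2.
  move=> pf f1; have CNf := C0_scale (-1) pf.1.
  have LN : L (fun x => -1 * f x) = - L f.
    have := L_lin (-1) pf.1 C0_zero; rewrite L0 mulN1r addr0 => <-; congr L.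
    by apply/funext => x; rewrite addr0.
  have : L (fun x => -1 * f x) <= 1.
    rewrite (le_trans (L_le CNf))//; apply: sup_norm_ler => x.
    by rewrite mulN1r normrN ger0_norm ?pf.2.
  by rewrite LN /L2; have := B1 _ pf f1; lra.
have [m1 [r1 E1]] := riesz_markov_C0 lcX hausX A1 B1.
have [m2 [r2 E2]] := riesz_markov_C0 lcX hausX A2 B2.
exists m1, m2; split => // f Cf.
have Cabs : C0 (fun x => `|f x|).
  apply: (@C0_dominated _ _ f _ 1) => //; first exact: continuous_abs Cf.1.
  by move=> x; rewrite normr_id mul1r.
have pa : C0pos (fun x => `|f x|) by [].
have ps : C0pos (fun x => `|f x| + f x).
  by split; [exact: C0_add|move=> x; rewrite -lerBlDr sub0r -normrN ler_norm].
have Lf : L f = L (fun x => `|f x| + f x) - L (fun x => `|f x|).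
  by rewrite LD// addrAC subrr add0r.
have If (m : {finite_measure set (borel_type X) -> \bar R}) : Rintegral m setT f =
    Rintegral m setT (fun x => `|f x| + f x) - Rintegral m setT (fun x => `|f x|).
  have -> := RintegralD measurableT (C0_integrable m Cabs) (C0_integrable m Cf).
  by rewrite addrAC subrr add0r.
by rewrite Lf !If !E1// !E2// /L2; ring.
Qed.

End functional.

(** The functional sending [t * f0 + g] to [t * eps] is dominated by the sup norm precisely because
    [f0] has distance at least [eps] from [E]: for [t > 0] factor out [t], for [t <= 0] the value is
    not positive. Its Hahn-Banach extension is represented by [m1] and [m2]. *)
Lemma C0_separation (E : set (X -> R)) (f0 : X -> R) (eps : R) :
  E `<=` C0 -> E (fun=> 0) ->
  (forall a f g, E f -> E g -> E (fun x => a * f x + g x)) ->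
  C0 f0 -> 0 < eps -> (forall g, E g -> eps <= sup_norm (fun x => f0 x - g x)) ->
  exists m1 m2 : {finite_measure set (borel_type X) -> \bar R},
  [/\ regular_measure m1, regular_measure m2,
      forall g, E g -> Rintegral m1 setT g = Rintegral m2 setT g &
      Rintegral m1 setT f0 != Rintegral m2 setT f0].
Proof.
move=> EC E0 Elin Cf0 eps0 far.
pose G0 : set ((X -> R) * R) := [set u | exists2 g, E g &
  exists t, u = ((fun x => t * f0 x + g x), t * eps)].
have dG0 : @dominated_graph _ (X -> R) C0 sup_norm G0.
  split.
  - exists (fun=> 0) => //; exists 0; rewrite mul0r; congr pair.
    by apply/funext => x; rewrite mul0r addr0.
  - move=> a _ _ [g Eg [s ->]] [h Eh [t ->]].
    exists (fun x => a * g x + h x); first exact: Elin.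
    exists (a * s + t); congr pair => /=; last by ring.
    apply/funext => x; rewrite /= -[LHS]/(a * (s * f0 x + g x) + (t * f0 x + h x)).
    by ring.
  - move=> _ [g Eg [t ->]] /=; have Cg := EC _ Eg; have Ct := C0_lin t Cf0 Cg.
    split => //; have [t0|t0] := leP t 0.
      by rewrite (le_trans _ (sup_norm_ge0 Ct))// mulr_le0_ge0// ltW.
    have Eg' : E (fun x => - t^-1 * g x + 0) by exact: Elin.
    rewrite (_ : (fun x => _) = fun x => t * (f0 x - (- t^-1 * g x + 0))).
      rewrite sup_normZ ?(ltW t0)//; last exact/C0_sub/EC.
      by rewrite ler_pM2l// far.
    by apply/funext => x; rewrite addr0 mulNr opprK mulrDr mulVKf ?gt_eqF.
have [|||l [l0 l_lin l_le]] := @hahn_banach _ (X -> R) C0 sup_norm _ _ _ G0 dG0.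
- by move=> a f g; exact: C0_lin.
- by move=> a f; exact: sup_normZ.
- by move=> f g; exact: sup_normD.
have [m1 [m2 [r1 r2 lm]]] := functional_signed_measure l_lin l_le.
exists m1, m2; split => //.
- move=> g Eg; apply/eqP; rewrite -subr_eq0 -lm; last exact: EC.
  rewrite (l0 (g, 0))//; exists g => //; exists 0; rewrite mul0r; congr pair.
  by apply/funext => x; rewrite mul0r add0r.
- rewrite -subr_eq0 -lm// (l0 (f0, eps)) ?gt_eqF//.
  exists (fun=> 0) => //; exists 1; rewrite mul1r; congr pair.
  by apply/funext => x; rewrite mul1r addr0.
Qed.

End separation.

(** * Signed measures and the duality criterion for density *)

Section signed_measures.
Context {R : realType} {X : ptopologicalType}.
Implicit Types m : {finite_measure set (borel_type X) -> \bar R}.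

(** Moving the subtracted terms across turns the hypothesis into equality of the measures [m1 + m4]
    and [m3 + m2], whose integrals are additive. *)
Lemma Rintegral_eq_differences m1 m2 m3 m4 (f : X -> R) : C0 f ->
  (forall A, measurable A -> m1 A - m2 A = m3 A - m4 A)%E ->
  Rintegral m1 setT f - Rintegral m2 setT f =
  Rintegral m3 setT f - Rintegral m4 setT f.
Proof.
move=> Cf m1234.
have I m := C0_integrable m Cf.
have F m : (\int[m]_x (f x)%:E)%E \is a fin_num.
  exact: (integrable_fin_num measurableT (I m)).
have ID m m' : (\int[measure_add m m']_x (f x)%:E =
    \int[m]_x (f x)%:E + \int[m']_x (f x)%:E)%E.
  apply: integral_measure_add => //; [exact: (I m)|exact: (I m')].
have E : (\int[m1]_x (f x)%:E + \int[m4]_x (f x)%:E =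
          \int[m3]_x (f x)%:E + \int[m2]_x (f x)%:E)%E.
  rewrite -!ID; apply: eq_measure_integral => A mA _.
  rewrite -[LHS]/(measure_add m1 m4 A) -[RHS]/(measure_add m3 m2 A) !measure_addE.
  have Fn m : m A \is a fin_num by exact: fin_num_measure.
  have := congr1 fine (m1234 A mA); rewrite !fineB ?Fn// => h.
  rewrite -[LHS]fineK ?fin_numD ?Fn// -[RHS]fineK ?fin_numD ?Fn//.
  congr EFin; rewrite !fineD ?Fn//; apply/eqP; move/eqP: h.
  by rewrite subr_eq addrAC eq_sym subr_eq eq_sym.
have : Rintegral m1 setT f + Rintegral m4 setT f =
    Rintegral m3 setT f + Rintegral m2 setT f.
  by have := congr1 fine E; rewrite (fineD (F m1) (F m4)) (fineD (F m3) (F m2)).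
move=> /eqP h; apply/eqP; rewrite subr_eq addrAC eq_sym subr_eq eq_sym.
exact: h.
Qed.

(** [charge_integral] uses one chosen Hahn decomposition, which [PN] reproduces; any other
    representation as a difference of finite measures has the same integrals. *)
Lemma charge_integral_difference (mu : {charge set (borel_type X) -> \bar R}) m1 m2 f :
  C0 f -> (forall A, measurable A -> mu A = m1 A - m2 A)%E ->
  charge_integral mu f = Rintegral m1 setT f - Rintegral m2 setT f.
Proof.
move=> Cf mu12; rewrite /charge_integral.
apply: (Rintegral_eq_differences Cf) => A mA.
pose PN := svalP (cid (svalP (cid (Hahn_decomposition mu)))).
by rewrite -mu12// (jordan_decomp PN mA) /cadd/= cscaleN1.
Qed.

Hypotheses (lcX : locally_compact [set: X]) (hausX : hausdorff_space X).

Lemma regular_measure_outer m (A : set (borel_type X)) (e : R) : regular_measure m ->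
  measurable A -> 0 < e ->
  exists O, [/\ open O, A `<=` O & fine (m O) < fine (m A) + e].
Proof.
move=> rm mA e0; have [_ mAE] := rm _ mA.
have fA : m A \is a fin_num by exact: fin_num_measure.
have [|_ [U [oU AU] <-]] := @lb_ereal_inf_adherent _
  [set m O | O in [set O : set X | open O /\ A `<=` O]] e e0; first by rewrite -mAE.
rewrite -mAE => lt; exists U; split => //.
have fU : m U \is a fin_num by apply: fin_num_measure; exact: open_borel_measurable.
by rewrite -lte_fin EFinD !fineK.
Qed.

(** For compact [K], open [U] around it and a Urysohn function [u], one has
    [m4 K <= int u dm4 = int u dm3 <= m3 U], and [m3 U] is close to [m3 K] by outer regularity. With
    the roles exchanged the measures agree on compact sets, and inner regularity does the rest. *)
Lemma regular_measure_eq m1 m2 : regular_measure m1 -> regular_measure m2 ->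
  (forall f, C0 f -> Rintegral m1 setT f = Rintegral m2 setT f) ->
  forall A, measurable A -> m1 A = m2 A.
Proof.
have key m3 m4 K : regular_measure m3 ->
    (forall f, C0 f -> Rintegral m3 setT f = Rintegral m4 setT f) ->
    compact K -> (m4 K <= m3 K)%E.
  move=> r3 E cK; have mK := closed_borel_measurable (compact_closed hausX cK).
  have Fn m : m K \is a fin_num by exact: fin_num_measure.
  rewrite -(fineK (Fn m3)) -(fineK (Fn m4)) lee_fin; apply/ler_addgt0Pr => e e0.
  have [U [oU KU Ult]] := regular_measure_outer r3 mK e0.
  have [u [Cu u01 uK uU]] := C0_urysohn (R := R) lcX hausX cK oU KU.
  rewrite (le_trans _ (ltW Ult))// (@le_trans _ _ (Rintegral m4 setT u))//.
    apply: Rintegral_ge_measure => //; first by move=> x; have /andP[] := u01 x.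
    by move=> x /uK->.
  rewrite -E//; apply: Rintegral_le_measure => //.
  - exact: open_borel_measurable.
  - by move=> x; have /andP[] := u01 x.
  - by move=> x /uU->.
move=> r1 r2 E A mA; rewrite (r1 A mA).1 (r2 A mA).1; congr ereal_sup.
apply/seteqP; split => _ [K [cK KA] <-]; exists K => //;
  apply/eqP; rewrite eq_le !key//.
- by move=> f Cf; rewrite E.
- by move=> f Cf; rewrite E.
Qed.

Lemma density_of_measures (A : set (X -> R)) : A `<=` C0 ->
  (forall mu : {charge set (borel_type X) -> \bar R}, finite_signed_radon mu ->
     (forall f, A f -> charge_integral mu f = 0) ->
     forall B, measurable B -> mu B = 0%E) <->
  sup_dense (fun_span A) C0.
Proof.
move=> AC; split=> [ann|[_ dense] mu [m1 [m2 [r1 r2 mu12]]] mu0 B mB].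
  split=> [|f0 Cf0 eps eps0]; first exact: C0_span.
  apply: contrapT => far.
  have far' g : fun_span A g -> eps <= sup_norm (fun x => f0 x - g x).
    by move=> Ag; rewrite leNgt; apply/negP => lt; apply: far; exists g.
  have [m1 [m2 [r1 r2 m12 /eqP]]] := C0_separation lcX hausX (C0_span AC)
    (fun_span0 A) (@fun_span_lin _ _ A) Cf0 eps0 far'.
  (* The difference of the separating measures annihilates [A], so it vanishes by hypothesis, while
     the integrals of [f0] differ. *)
  apply; pose mu := cadd (charge_of_finite_measure m1)
    (copp (charge_of_finite_measure m2)).
  have muE B : measurable B -> mu B = (m1 B - m2 B)%E by [].
  have mu0 : forall B, measurable B -> mu B = 0%E.
    apply: ann; first by exists m1, m2.
    move=> f Af; rewrite (charge_integral_difference (AC _ Af) muE) m12 ?subrr//.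
    exact: sub_fun_span.
  congr fine; apply: eq_measure_integral => B mB _.
  have := mu0 B mB; rewrite muE// => /eqP.
  by rewrite sube_eq ?add0e ?fin_num_adde_defl ?fin_num_measure// => /eqP.
suff -> : mu B = (m1 B - m2 B)%E.
  rewrite (regular_measure_eq r1 r2 _ mB) ?subee ?fin_num_measure// => f Cf.
  apply/eqP; rewrite -subr_eq0 -normr_le0; apply/ler_addgt0Pr => e e0.
  (* Replacing [f] by [g] changes the two integrals by at most [e / (M + 1) * M] in total; [M + 1]
     is used as the total mass [M] may be zero. *)
  pose M := fine (m1 setT) + fine (m2 setT).
  have M0 : 0 <= M by rewrite addr_ge0// fine_ge0.
  have M1 : 0 < M + 1 by rewrite ltr_pwDr.
  have [g Ag lt] := dense _ Cf _ (divr_gt0 e0 M1).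
  have Cg : C0 g by exact: C0_span Ag.
  have Cfg := C0_sub Cf Cg.
  have bnd (m : {finite_measure set (borel_type X) -> \bar R}) :
      `|Rintegral m setT f - Rintegral m setT g| <= e / (M + 1) * fine (m setT).
    have [If Ig] := (C0_integrable m Cf, C0_integrable m Cg).
    have <- := RintegralB measurableT If Ig.
    apply: Rintegral_sup_bound => // x; apply: ltW; apply: le_lt_trans lt.
    exact: ler_sup_norm Cfg.
  have mu_g : Rintegral m1 setT g = Rintegral m2 setT g.
    case: Ag => n [c [u [Au ->]]].
    have Cu i : C0 (u i) by exact: AC.
    rewrite !Rintegral_C0_sum//.
    apply: eq_bigr => i _; have := mu0 _ (Au i).
    rewrite (charge_integral_difference (AC _ (Au i)) mu12) => /eqP.
    by rewrite subr_eq0 => /eqP->.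
  have := lerD (bnd m1) (bnd m2); rewrite mu_g -mulrDr -/M add0r => bM.
  have : e / (M + 1) * M <= e by rewrite mulrAC ler_pdivrMr// ler_pM2l// lerDl.
  apply: le_trans; apply: le_trans bM.
  rewrite [X in _ <= _ + X]distrC (le_trans _ (ler_normD _ _))//.
  by rewrite addrA subrK.
exact: mu12.
Qed.

End signed_measures.

(** * Hilbert spaces of functions *)

Section hilbert_space.
Context {R : realType} {X : ptopologicalType}.
Variables (H : set (X -> R)) (ip : (X -> R) -> (X -> R) -> R).
Hypothesis hH : function_hilbert_space H ip.
Implicit Types f g h u v w : X -> R.

Lemma hilbert_scale (a : R) f : H f -> H (fun x => a * f x).
Proof.
move=> Hf; have := hilbert_lin hH a Hf (hilbert_zero hH).
by under eq_fun do rewrite addr0.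
Qed.

Lemma hilbert_add f g : H f -> H g -> H (fun x => f x + g x).
Proof.
by move=> Hf Hg; have := hilbert_lin hH 1 Hf Hg; under eq_fun do rewrite mul1r.
Qed.

Lemma hilbert_sub f g : H f -> H g -> H (fun x => f x - g x).
Proof.
move=> Hf Hg; have := hilbert_lin hH (-1) Hg Hf.
by under eq_fun do rewrite mulN1r addrC.
Qed.

Lemma ip0l h : H h -> ip (fun=> 0) h = 0.
Proof.
move=> Hh; have H0 := hilbert_zero hH.
have := hilbert_ip_lin hH 1 H0 H0 Hh; under eq_fun do rewrite mulr0 addr0.
by lra.
Qed.

Lemma ipDl f g h : H f -> H g -> H h -> ip (fun x => f x + g x) h = ip f h + ip g h.
Proof.
move=> Hf Hg Hh; have := hilbert_ip_lin hH 1 Hf Hg Hh; rewrite mul1r => <-.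
by under [in RHS]eq_fun do rewrite mul1r.
Qed.

Lemma ipZl (a : R) f h : H f -> H h -> ip (fun x => a * f x) h = a * ip f h.
Proof.
move=> Hf Hh; have := hilbert_ip_lin hH a Hf (hilbert_zero hH) Hh.
by rewrite ip0l// addr0 => <-; under [in RHS]eq_fun do rewrite addr0.
Qed.

Lemma ipBl f g h : H f -> H g -> H h -> ip (fun x => f x - g x) h = ip f h - ip g h.
Proof.
move=> Hf Hg Hh; have := hilbert_ip_lin hH (-1) Hg Hf Hh; rewrite mulN1r addrC => <-.
by under [in RHS]eq_fun do rewrite mulN1r addrC.
Qed.

Lemma ip0r h : H h -> ip h (fun=> 0) = 0.
Proof. by move=> Hh; rewrite (hilbert_ip_sym hH) ?ip0l//; exact: (hilbert_zero hH). Qed.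

Lemma ipDr f g h : H f -> H g -> H h -> ip h (fun x => f x + g x) = ip h f + ip h g.
Proof.
move=> Hf Hg Hh; rewrite (hilbert_ip_sym hH)//; last exact: hilbert_add.
by rewrite ipDl// !(hilbert_ip_sym hH Hh).
Qed.

Lemma ipZr (a : R) f h : H f -> H h -> ip h (fun x => a * f x) = a * ip h f.
Proof.
move=> Hf Hh; rewrite (hilbert_ip_sym hH)//; last exact: hilbert_scale.
by rewrite ipZl// (hilbert_ip_sym hH Hh).
Qed.

Lemma ipBr f g h : H f -> H g -> H h -> ip h (fun x => f x - g x) = ip h f - ip h g.
Proof.
move=> Hf Hg Hh; rewrite (hilbert_ip_sym hH)//; last exact: hilbert_sub.
by rewrite ipBl// !(hilbert_ip_sym hH Hh).
Qed.

Lemma ip_sum (J : Type) (s : seq J) (c : J -> R) (u : J -> X -> R) h :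
  (forall j, H (u j)) -> H h ->
  H (fun x => \sum_(j <- s) c j * u j x) /\
  ip (fun x => \sum_(j <- s) c j * u j x) h = \sum_(j <- s) c j * ip (u j) h.
Proof.
move=> Hu Hh; elim: s => [|j s [Hs ih]].
  under eq_fun do rewrite big_nil.
  by rewrite big_nil; split; [exact: hilbert_zero hH|exact: ip0l].
under eq_fun do rewrite big_cons.
rewrite big_cons -ih; split; first exact: (hilbert_lin hH).
exact: (hilbert_ip_lin hH).
Qed.

Local Notation N := (ip_norm ip).

Lemma ip_norm_ge0 f : 0 <= N f. Proof. exact: sqrtr_ge0. Qed.

Lemma sqr_ip_norm f : H f -> N f ^+ 2 = ip f f.
Proof. by move=> Hf; rewrite sqr_sqrtr//; exact: (hilbert_ip_ge0 hH Hf). Qed.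

Lemma sqr_ip_le f g : H f -> H g -> ip f g ^+ 2 <= ip f f * ip g g.
Proof.
move=> Hf Hg; have [g0|g0] := eqVneq (ip g g) 0.
  rewrite (hilbert_ip_eq0 hH Hg g0) ip0r//.
  rewrite expr2 mul0r.
  by apply: mulr_ge0; apply: (hilbert_ip_ge0 hH) => //; exact: (hilbert_zero hH).
have gp : 0 < ip g g by rewrite lt_def g0 (hilbert_ip_ge0 hH Hg).
pose t := ip f g / ip g g.
have Htg : H (fun x => t * g x) by exact: hilbert_scale.
have := hilbert_ip_ge0 hH (hilbert_sub Hf Htg).
rewrite ipBl ?ipBr ?ipZl ?ipZr//; last exact: hilbert_sub.
rewrite (hilbert_ip_sym hH Hg Hf) => /(mulr_ge0 (ltW gp)).
have tg : t * ip g g = ip f g by rewrite divfK.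
rewrite (_ : ip g g * _ = ip f f * ip g g - ip f g * (t * ip g g) -
  ip f g * (t * ip g g) + (t * ip g g) * (t * ip g g)); last by ring.
by rewrite tg; lra.
Qed.

Lemma ip_le_norm f g : H f -> H g -> `|ip f g| <= N f * N g.
Proof.
move=> Hf Hg; rewrite -(@ler_pXn2r _ 2)// ?nnegrE ?mulr_ge0 ?ip_norm_ge0//.
by rewrite real_normK ?num_real// exprMn !sqr_ip_norm// sqr_ip_le.
Qed.

End hilbert_space.

(** * Riesz representation on subspaces *)

Section weak_compactness.
Context {R : realType} {X : ptopologicalType}.
Variables (H : set (X -> R)) (ip : (X -> R) -> (X -> R) -> R).
Hypothesis hH : function_hilbert_space H ip.
Implicit Types f g h v w : X -> R.
Local Notation N := (ip_norm ip).

Lemma ip_norm_cvg_weak (u : nat -> X -> R) f w : (forall n, H (u n)) -> H f -> H w ->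
  N (fun x => u n x - f x) @[n --> \oo] --> (0 : R) ->
  ip (u n) w @[n --> \oo] --> ip f w.
Proof.
move=> Hu Hf Hw uf; apply/cvgrPdist_lt => e e0.
have N1 : 0 < N w + 1 by rewrite ltr_pwDr// ip_norm_ge0.
move/cvgrPdist_lt : uf => /(_ _ (divr_gt0 e0 N1)); apply: filterS => n.
rewrite sub0r normrN ger0_norm ?ip_norm_ge0// ltr_pdivlMr// => lt.
rewrite distrC -(ipBl hH)//; apply: le_lt_trans lt.
have Huf : H (fun x => u n x - f x) by exact: (hilbert_sub hH).
rewrite (le_trans (ip_le_norm hH Huf Hw))// ler_wpM2l ?ip_norm_ge0//.
by rewrite lerDl.
Qed.

(* The representer minimises [ip v v - 2 phi v] over the closure of [V]; a
   minimising sequence in [V] is Cauchy by the parallelogram identity. *)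
Theorem riesz_representation (V : set (X -> R)) (phi : (X -> R) -> R) (C : R) :
  V `<=` H -> V (fun=> 0) ->
  (forall a v w, V v -> V w -> V (fun x => a * v x + w x)) ->
  (forall a v w, V v -> V w -> phi (fun x => a * v x + w x) = a * phi v + phi w) ->
  (forall v, V v -> phi v ^+ 2 <= C * ip v v) ->
  exists f, [/\ H f,
    exists2 u : nat -> X -> R, (forall n, V (u n)) &
      N (fun x => u n x - f x) @[n --> \oo] --> (0 : R) &
    forall v, V v -> phi v = ip f v].
Proof.
move=> VH V0 Vlin phi_lin phi_le.
pose J v := ip v v - 2 * phi v.
have JE v w (t : R) : V v -> V w -> J (fun x => t * w x + v x) =
    J v + 2 * t * (ip v w - phi w) + t ^+ 2 * ip w w.
  move=> Vv Vw; have [Hv Hw] := (VH _ Vv, VH _ Vw).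
  have Htw := hilbert_scale hH t Hw.
  rewrite /J phi_lin// (ipDl hH) ?(ipDr hH)//; last exact: (hilbert_add hH).
  rewrite !(ipZl hH)// !(ipZr hH)// (hilbert_ip_sym hH Hw Hv); by ring.
(* With [s = ip v v], [p = phi v] and [c = |C|], a value below [- c] would mean [s + c < 2 * p],
   hence [(s + c)^2 < 4 * p^2 <= 4 * c * s], against [(s - c)^2 >= 0]. *)
have J_ge v : V v -> - `|C| <= J v.
  move=> Vv; have s0 := hilbert_ip_ge0 hH (VH _ Vv).
  have := phi_le _ Vv; have := ler_wpM2r s0 (ler_norm C).
  have C0 := normr_ge0 C; rewrite /J.
  move: (ip v v) (phi v) (`|C|) s0 C0 => s p c s0 c0 h1 h2.
  have h3 : p ^+ 2 <= c * s by exact: le_trans h1.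
  rewrite leNgt; apply/negP => lt0.
  have lt : s + c < 2 * p by move: lt0; lra.
  have sc0 : 0 <= s + c by rewrite addr_ge0.
  have := ltr_pM sc0 sc0 lt lt; rewrite -!expr2.
  have := sqr_ge0 (s - c); move: h3; rewrite !expr2; lra.
have has_infJ : has_inf [set J v | v in V].
  split; first by exists (J (fun=> 0)), (fun=> 0).
  by exists (- `|C|) => _ [v Vv <-]; exact: J_ge.
pose m := inf [set J v | v in V].
have m_le v : V v -> m <= J v.
  by move=> Vv; apply: ge_inf; [exact: has_infJ.2|exists v].
have /choice[u uP] n : exists v, V v /\ J v < m + n.+1%:R^-1.
  have n0 : 0 < n.+1%:R^-1 :> R by rewrite invr_gt0.
  by have [_ [v Vv <-] lt] := inf_adherent n0 has_infJ; exists v.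
have Vu n : V (u n) := (uP n).1.
have Hu n : H (u n) := VH _ (Vu n).
(* [J] is at least [m] at the midpoint of [u a] and [u b]; the coefficient 1/2 in [E2] produces that
   midpoint. *)
have u_cauchy a b : ip (fun x => u a x - u b x) (fun x => u a x - u b x) <=
    2 * (a.+1%:R^-1 + b.+1%:R^-1).
  pose w x := - 1 * u b x + u a x.
  have Vw : V w by exact: Vlin.
  have -> : (fun x => u a x - u b x) = w by apply/funext => x; rewrite /w mulN1r addrC.
  have E1 := JE _ _ 1 (Vu b) Vw; have E2 := JE _ _ 2^-1 (Vu b) Vw.
  have uaE : (fun x => 1 * w x + u b x) = u a.
    by apply/funext => x; rewrite /w mul1r mulN1r addrC addrA subrr add0r.
  rewrite uaE in E1; have := m_le _ (Vlin 2^-1 _ _ Vw (Vu b)); rewrite E2.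
  have [_ la] := uP a; have [_ lb] := uP b.
  have -> : 2^-1 ^+ 2 = 4^-1 :> R by rewrite exprVn -natrX.
  move: E1 la lb; rewrite expr1n !mul1r mulr1 mulfV// mul1r.
  move: (J (u a)) (J (u b)) (ip (u b) w - phi w) (ip w w) (a.+1%:R^-1) (b.+1%:R^-1).
  by clear; move=> *; lra.
have [|f Hf uf] := hilbert_complete hH Hu.
  move=> e e0; pose n0 := Num.trunc (4 / e ^+ 2); exists n0 => a b n0a n0b.
  rewrite -(@ltr_pXn2r _ 2)// ?nnegrE ?ip_norm_ge0 ?(ltW e0)//.
  rewrite (sqr_ip_norm hH); last exact: (hilbert_sub hH).
  apply: (le_lt_trans (u_cauchy a b)).
  have inv_le c : (n0 <= c)%N -> c.+1%:R^-1 <= n0.+1%:R^-1 :> R.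
    by move=> n0c; rewrite lef_pV2 ?posrE ?ltr0n// ler_nat.
  have := lerD (inv_le _ n0a) (inv_le _ n0b).
  have : 4 / n0.+1%:R < e ^+ 2.
    rewrite ltr_pdivrMr ?ltr0n// mulrC -ltr_pdivrMr ?exprn_gt0//.
    exact: truncnS_gt.
  move: (n0.+1%:R^-1) (a.+1%:R^-1) (b.+1%:R^-1) (e ^+ 2).
  by clear; move=> *; lra.
exists f; split => //; first by exists u.
move=> w Vw; have Hw := VH _ Vw.
pose a := ip f w - phi w; pose s := ip w w.
have s0 : 0 <= s := hilbert_ip_ge0 hH Hw.
have q_ge0 t : 0 <= 2 * t * a + t ^+ 2 * s.
  have lim : 2 * t * (ip (u n) w - phi w) + t ^+ 2 * s + n.+1%:R^-1 @[n --> \oo] -->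
      2 * t * a + t ^+ 2 * s + 0.
    apply: cvgD; last exact: cvg_harmonic.
    apply: cvgD; last exact: cvg_cst.
    apply: cvgM; first exact: cvg_cst.
    apply: cvgB; last exact: cvg_cst.
    exact: ip_norm_cvg_weak uf.
  rewrite -[leRHS]addr0 -(cvg_lim _ lim)//; apply: limr_ge.
    by apply/cvg_ex; eexists; exact: lim.
  apply: nearW => n; have [_ lt] := uP n.
  have := m_le _ (Vlin t _ _ Vw (Vu n)); rewrite JE// -/s.
  move: lt; move: (J (u n)) (n.+1%:R^-1) (2 * t * _) (t ^+ 2 * s).
  by clear; move=> *; lra.
have s1 : 0 < s + 1 by rewrite ltr_pwDr.
(* Nearly the minimiser [- a / s] of the quadratic in [t], with [s + 1] because [s] may vanish. The
   value there is negative unless [a = 0]. *)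
have := q_ge0 (- a / (s + 1)).
have -> : 2 * (- a / (s + 1)) * a + (- a / (s + 1)) ^+ 2 * s =
    - (a ^+ 2 * (s + 2)) / (s + 1) ^+ 2.
  by field; rewrite gt_eqF.
rewrite mulNr oppr_ge0 pmulr_lle0 ?invr_gt0 ?exprn_gt0//.
rewrite pmulr_lle0 ?ltr_wpDl// => a2.
have /eqP : a ^+ 2 = 0 by apply/eqP; rewrite eq_le a2 sqr_ge0.
by rewrite sqrf_eq0 subr_eq0 => /eqP.
Qed.

End weak_compactness.

(** * Weak sequential compactness of the unit ball *)

(** A cluster point [c] of the rows in the compact product of intervals replaces the diagonal
    argument: [phi j] is an index at least [j] whose row is within [1/(j+1)] of [c] in the
    coordinates up to [j]. The map [phi] need not be increasing; [j <= phi j] suffices for passing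
    to limits. *)
Lemma bounded_array_subsequence {R : realType} (a : nat -> nat -> R) :
  (forall n m, `|a n m| <= 1) ->
  exists (c : nat -> R) (phi : nat -> nat), (forall j, (j <= phi j)%N) /\
    forall m, a (phi j) m @[j --> \oo] --> c m.
Proof.
move=> a1.
pose T (_ : nat) : topologicalType := R.
have cK := @tychonoff nat T (fun _ => `[-1, 1]%classic)
  (fun _ => @segment_compact R (-1) 1).
pose F : set_system (prod_topology T) := (fun n => a n : prod_topology T) @ \oo.
have [|c [_ clc]] := cK F _.
  by exists 0%N => // n _ m; rewrite /= in_itv/= -ler_norml.
have near_c j : exists n, (j <= n)%N /\ forall m : 'I_j.+1, `|c m - a n m| < j.+1%:R^-1.
  have Fj : F [set f | exists2 n, (j <= n)%N & f = a n].
    by exists j => // n /= jn; exists n.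
  have cj : nbhs (c : prod_topology T)
      [set f : prod_topology T | forall m : 'I_j.+1, `|c m - f m| < j.+1%:R^-1].
    apply: (@filter_forall _ 'I_j.+1 (fun m => [set f : prod_topology T |
      `|c m - f m| < j.+1%:R^-1]) (nbhs (c : prod_topology T)) _) => m.
    apply: (@proj_continuous nat T m c [set y : R | `|(c m : R) - y| < j.+1%:R^-1]).
    by apply: (@nbhsx_ballx R R^o); rewrite invr_gt0.
  by have [f [[n jn ->] fm]] := clc _ _ Fj cj; exists n.
have [phi phiP] := choice near_c.
exists c, phi; split=> [j|m]; first exact: (phiP j).1.
apply/cvgrPdist_lt => e e0.
have /cvgr0Pnorm_lt /(_ e e0)[N _ NP] := @cvg_harmonic R.
exists (maxn N m) => // j /=; rewrite geq_max => /andP[Nj mj].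
have mj' : (m < j.+1)%N by rewrite ltnS.
have [_ /(_ (Ordinal mj'))/=] := phiP j; move=> /lt_trans; apply.
by have := NP j Nj; rewrite /= ger0_norm ?invr_ge0.
Qed.

Section weak_sequential_compactness.
Context {R : realType} {X : ptopologicalType}.
Variables (H : set (X -> R)) (ip : (X -> R) -> (X -> R) -> R).
Hypothesis hH : function_hilbert_space H ip.
Local Notation N := (ip_norm ip).

(** A subsequence along which all [ip (f n) (f m)] converge has a limit functional on the span [V]
    of the sequence, and [g] represents it. An arbitrary [y] is replaced by its projection [p] onto
    the closure of [V]: pairing with the [f n] and with their limit [g] does not distinguish [y]
    from [p], and [p] is approximated from [V]. *)
Theorem weak_sequential_compactness (f : nat -> X -> R) :
  (forall n, H (f n)) -> (forall n, ip (f n) (f n) <= 1) ->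
  exists (g : X -> R) (phi : nat -> nat), [/\ H g, ip g g <= 1,
    forall j, (j <= phi j)%N &
    forall y, H y -> ip (f (phi j)) y @[j --> \oo] --> ip g y].
Proof.
move=> Hf f1.
have N1 n : N (f n) <= 1 by rewrite -[leRHS]sqrtr1 ler_wsqrtr.
have [n m|c [phi [phi_ge phi_cvg]]] :=
  @bounded_array_subsequence R (fun n m => ip (f n) (f m)).
  rewrite (le_trans (ip_le_norm hH (Hf n) (Hf m)))//.
  by rewrite mulr_ile1 ?ip_norm_ge0.
pose V := fun_span (range f).
have V_H : V `<=` H.
  move=> _ [n [d [v [fv ->]]]]; apply: (ip_sum hH _ _ _ (hilbert_zero hH)).1.
  by move=> j; have [i _ <-] := fv j.
have V_cvg v : V v -> cvg (ip (f (phi j)) v @[j --> \oo]).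
  move=> [n [d [u [fu ->]]]].
  have Hu i : H (u i) by have [j _ <-] := fu i.
  have -> : (fun j => ip (f (phi j)) (fun x => \sum_(i < n) d i * u i x)) =
      (fun j => \sum_(i < n) d i * ip (f (phi j)) (u i)).
    apply/funext => j; have [Hs E] := ip_sum hH (index_enum _) d Hu (Hf (phi j)).
    rewrite (hilbert_ip_sym hH (Hf _) Hs) E; apply: eq_bigr => i _.
    by rewrite (hilbert_ip_sym hH (Hf _) (Hu i)).
  elim: (index_enum _) => [|i s ih].
    by under eq_fun do rewrite big_nil; exact: is_cvg_cst.
  under eq_fun do rewrite big_cons.
  apply: is_cvgD => //; apply: is_cvgM; first exact: is_cvg_cst.
  by have [m _ <-] := fu i; apply/cvg_ex; exists (c m).
pose psi v := lim (ip (f (phi j)) v @[j --> \oo]).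
have V0 : V (fun=> 0) := fun_span0 _.
have Vlin a v w : V v -> V w -> V (fun x => a * v x + w x) by exact: fun_span_lin.
have psi_lin a v w : V v -> V w -> psi (fun x => a * v x + w x) = a * psi v + psi w.
  move=> Vv Vw; apply/cvg_lim => //.
  have [Hv Hw] := (V_H _ Vv, V_H _ Vw).
  have -> : (fun j => ip (f (phi j)) (fun x => a * v x + w x)) =
      (fun j => a * ip (f (phi j)) v + ip (f (phi j)) w).
    by apply/funext => j; rewrite (ipDr hH) ?(ipZr hH)//; exact: (hilbert_scale hH).
  apply: cvgD; last exact: V_cvg.
  by apply: cvgM; [exact: cvg_cst|exact: V_cvg].
have psi_le v : V v -> psi v ^+ 2 <= 1 * ip v v.
  move=> Vv; have Hv := V_H _ Vv; rewrite mul1r -(sqr_ip_norm hH)//.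
  rewrite -[psi v ^+ 2]real_normK ?num_real// ler_pXn2r ?nnegrE ?ip_norm_ge0//.
  have nc : `|ip (f (phi j)) v| @[j --> \oo] --> `|psi v|.
    by apply: cvg_norm; exact: V_cvg.
  rewrite -(cvg_lim _ nc)//; apply: limr_le; first by apply/cvg_ex; eexists; exact: nc.
  apply: nearW => j; rewrite (le_trans (ip_le_norm hH (Hf _) Hv))//.
  by rewrite ler_piMl ?ip_norm_ge0.
have [g [Hg [u Vu ug] psiE]] := riesz_representation hH V_H V0 Vlin psi_lin psi_le.
have g_cvgV v : V v -> ip (f (phi j)) v @[j --> \oo] --> ip g v.
  by move=> Vv; rewrite -psiE//; exact: V_cvg.
have g_cvg y : H y -> ip (f (phi j)) y @[j --> \oo] --> ip g y.
  move=> Hy.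
  have y_lin a v w : V v -> V w -> ip y (fun x => a * v x + w x) = a * ip y v + ip y w.
    move=> /V_H Hv /V_H Hw.
    by rewrite (ipDr hH) ?(ipZr hH)//; exact: (hilbert_scale hH).
  have y_le v : V v -> ip y v ^+ 2 <= ip y y * ip v v.
    by move=> /V_H Hv; exact: (sqr_ip_le hH).
  have [p [Hp [w Vw wp] yE]] := riesz_representation hH V_H V0 Vlin y_lin y_le.
  have fyp j : ip (f (phi j)) y = ip (f (phi j)) p.
    have Vf : V (f (phi j)) by apply: sub_fun_span; exists (phi j).
    by rewrite (hilbert_ip_sym hH (Hf _) Hy) yE// (hilbert_ip_sym hH Hp (Hf _)).
  have gyp : ip g y = ip g p.
    have Hu n : H (u n) by exact: V_H.
    have c1 := ip_norm_cvg_weak hH Hu Hg Hy ug.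
    have c2 := ip_norm_cvg_weak hH Hu Hg Hp ug.
    have E : (fun n => ip (u n) y) = (fun n => ip (u n) p).
      apply/funext => n.
      by rewrite (hilbert_ip_sym hH (Hu _) Hy) yE// (hilbert_ip_sym hH Hp (Hu _)).
    by rewrite E in c1; exact: (cvg_unique _ c1 c2).
  rewrite gyp (_ : (fun j => _) = fun j => ip (f (phi j)) p); last exact/funext.
  apply/cvgrPdist_lt => e e0.
  have e3 : 0 < e / 3 by rewrite divr_gt0.
  have Ng1 : 0 < N g + 1 by rewrite ltr_pwDr// ip_norm_ge0.
  (* The approximation [v] of [p] must be good against both the [f n], of norm at most 1, and [g],
     whose norm is not yet bounded. *)
  have e4 : 0 < Num.min (e / 3) (e / 3 / (N g + 1)).
    by rewrite lt_min e3 divr_gt0.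
  have /cvgrPdist_lt /(_ _ e4)[n0 _ /(_ n0 (leqnn _))] := wp.
  rewrite sub0r normrN ger0_norm ?ip_norm_ge0// lt_min => /andP[w1 w2].
  set v := w n0 in w1 w2; have Vv : V v by exact: Vw.
  have Hv := V_H _ Vv; have Hvp := hilbert_sub hH Hv Hp.
  have /cvgrPdist_lt /(_ _ e3) := g_cvgV v Vv; apply: filterS => j vj.
  have -> : ip g p - ip (f (phi j)) p = - ip g (fun x => v x - p x) +
      (ip g v - ip (f (phi j)) v) + ip (f (phi j)) (fun x => v x - p x).
    by rewrite !(ipBr hH)//; ring.
  have b1 : `|ip g (fun x => v x - p x)| < e / 3.
    rewrite (le_lt_trans (ip_le_norm hH Hg Hvp))//.
    move: w2; rewrite ltr_pdivlMr// => /(le_lt_trans _); apply.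
    by rewrite mulrC ler_wpM2l ?ip_norm_ge0// lerDl.
  have b2 : `|ip (f (phi j)) (fun x => v x - p x)| < e / 3.
    rewrite (le_lt_trans (ip_le_norm hH (Hf _) Hvp))//.
    by apply: le_lt_trans w1; rewrite ler_piMl ?ip_norm_ge0.
  rewrite (le_lt_trans (ler_normD _ _))//.
  have := ler_normD (- ip g (fun x => v x - p x)) (ip g v - ip (f (phi j)) v).
  by rewrite normrN; move: vj b1 b2; lra.
exists g, phi; split => //.
have nc : `|ip (f (phi j)) g| @[j --> \oo] --> `|ip g g|.
  by apply: cvg_norm; exact: g_cvg.
(* [ip g g] is the limit of [ip (f (phi j)) g], bounded by [N g]; thus the square of [N g] is at
   most [N g], which forces [N g <= 1]. *)
have : `|ip g g| <= N g.
  rewrite -(cvg_lim _ nc)//; apply: limr_le; first by apply/cvg_ex; eexists; exact: nc.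
  apply: nearW => j; rewrite (le_trans (ip_le_norm hH (Hf _) Hg))//.
  by rewrite ler_piMl ?ip_norm_ge0.
rewrite -(sqr_ip_norm hH)// ger0_norm ?exprn_ge0 ?ip_norm_ge0// => Ng.
have [Ng1|Ng1] := leP (N g) 1; first by rewrite exprn_ile1 ?ip_norm_ge0.
have : N g * 1 < N g * N g by rewrite ltr_pM2l// (lt_trans ltr01).
by move: Ng; rewrite expr2 mulr1 => Ng /lt_le_trans /(_ Ng); rewrite ltxx.
Qed.

End weak_sequential_compactness.

(** * The integral operator *)

Section square_integrable.
Context d (T : measurableType d) (R : realType).
Variable nu : {measure set T -> \bar R}.
Implicit Types f g : T -> R.

Lemma Lnorm2E f :
  ('N[nu]_2%:E[EFin \o f] = (\int[nu]_x (f x ^+ 2)%:E) `^ 2^-1)%E.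
Proof.
rewrite unlock; congr (_ `^ _)%E; apply: eq_integral => x _.
by rewrite abse_EFin poweR_EFin powR_mulrn// real_normK ?num_real.
Qed.

Lemma Lfun2P f : measurable_fun setT f ->
  (\int[nu]_x (f x ^+ 2)%:E < +oo)%E -> f \in Lfun nu 2%:E.
Proof.
move=> mf foo; rewrite inE; apply/andP; split; first by rewrite inE.
by rewrite inE /= /finite_norm Lnorm2E poweR_lty.
Qed.

Lemma Lnorm2_lt f (eps : R) : 0 < eps ->
  (\int[nu]_x (f x ^+ 2)%:E < (eps ^+ 2)%:E)%E -> ('N[nu]_2%:E[EFin \o f] < eps%:E)%E.
Proof.
move=> eps0; rewrite Lnorm2E.
have : (0 <= \int[nu]_x (f x ^+ 2)%:E)%E.
  by apply: integral_ge0 => x _; rewrite lee_fin sqr_ge0.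
case: (\int[nu]_x (f x ^+ 2)%:E)%E => [r| |]//; rewrite lee_fin lte_fin => r0 lt.
rewrite poweR_EFin lte_fin powR12_sqrt//.
by rewrite -(@ltr_pXn2r _ 2)// ?nnegrE ?sqrtr_ge0 ?(ltW eps0)// sqr_sqrtr.
Qed.

Lemma Lfun_measurable f p : f \in Lfun nu p -> measurable_fun setT f.
Proof. by rewrite inE => /andP[]; rewrite inE. Qed.

End square_integrable.

Section strictly_positive.
Context {R : realType} {X : ptopologicalType}.
Variable nu : {measure set (borel_type X) -> \bar R}.
Hypothesis nu_pos : strictly_positive nu.

(** The set where [f] and [g] differ is open and contained in a null set. *)
Lemma continuous_ae_eq (f g : X -> R) : continuous f -> continuous g ->
  (f : borel_type X -> R) = g %[ae nu] -> f = g.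
Proof.
move=> cf cg [Z [mZ Z0 fgZ]]; apply/funext => x; apply/eqP; apply/negPn/negP => fgx.
pose h y := `|f y - g y|.
have oO : open [set y | 0 < h y].
  apply: (@open_comp _ _ h [set t | 0 < t]); last exact: open_gt.
  move=> y _; apply: (@continuous_abs _ _ (fun y => f y - g y)) => z.
  by apply: cvgB; [exact: cf|exact: cg].
have /(nu_pos oO) : [set y | 0 < h y] !=set0 by exists x; rewrite /= normr_gt0 subr_eq0.
apply/negP; rewrite -leNgt -Z0; apply: le_measure; rewrite ?inE//.
  exact: open_borel_measurable.
move=> y /=; rewrite /h normr_gt0 subr_eq0 => fgy; apply: fgZ => /= H.
by move: fgy; rewrite (H I) eqxx.
Qed.

End strictly_positive.

Section rkhs_L2.
Context {R : realType} {X : ptopologicalType}.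
Variable nu : {measure set (borel_type X) -> \bar R}.
Hypothesis nu_pos : strictly_positive nu.
Variables (k : X -> X -> R) (H : set (X -> R)) (ip : (X -> R) -> (X -> R) -> R).
Hypotheses (rkhsH : is_rkhs k H ip) (kC0 : C0_kernel k H)
  (k_int : (\int[nu]_x (k x x)%:E < +oo)%E).
Implicit Types f g h : X -> R.
Local Notation N := (ip_norm ip).

Let hH : function_hilbert_space H ip := rkhs_hilbert rkhsH.

Let H_cont f : H f -> continuous f.
Proof. by move=> Hf; have [_ _ _ HC] := kC0; exact: (HC _ Hf).1. Qed.

Let H_meas f : H f -> measurable_fun setT (f : borel_type X -> R).
Proof. by move=> Hf; exact: (continuous_borel_measurable (H_cont Hf)). Qed.

Let Hk x : H (k x) := rkhs_section rkhsH x.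

Lemma ip_norm_section x : N (k x) ^+ 2 = k x x.
Proof. by rewrite (sqr_ip_norm hH)// -(rkhs_reproducing rkhsH x (Hk x)). Qed.

Lemma diag_ge0 x : 0 <= k x x.
Proof. by rewrite -ip_norm_section sqr_ge0. Qed.

Lemma rkhs_eval_le f x : H f -> `|f x| <= N f * N (k x).
Proof.
by move=> Hf; rewrite [f x](rkhs_reproducing rkhsH x Hf); exact: (ip_le_norm hH).
Qed.

Lemma rkhs_sup_norm (M : R) f : (forall x, k x x <= M) -> H f ->
  sup_norm f <= N f * Num.sqrt M.
Proof.
move=> kM Hf; apply: sup_norm_ler => x; rewrite (le_trans (rkhs_eval_le x Hf))//.
rewrite ler_wpM2l ?ip_norm_ge0//.
by rewrite -(ger0_norm (ip_norm_ge0 ip (k x))) -sqrtr_sqr ip_norm_section ler_wsqrtr.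
Qed.

(** This makes the integrable diagonal of [k] a common majorant for all products of elements of H,
    uniformly on balls. *)
Lemma rkhs_mul_le f g x : H f -> H g -> `|f x * g x| <= N f * N g * k x x.
Proof.
move=> Hf Hg; rewrite normrM -ip_norm_section expr2 mulrACA.
by rewrite ler_pM ?rkhs_eval_le.
Qed.

Lemma diag_integrable : nu.-integrable setT (EFin \o (fun x : borel_type X => k x x)).
Proof.
have [_ _ ck _] := kC0.
have ckd : continuous (fun x => k x x).
  move=> x; apply: (@continuous_comp _ _ _ (fun x => (x, x))
    (fun p : X * X => k p.1 p.2)).
    by apply: cvg_pair.
  exact: ck.
apply/integrableP; split.
  by apply/measurable_EFinP; exact: (continuous_borel_measurable ckd).
rewrite (_ : (\int[nu]_x _)%E = (\int[nu]_x (k x x)%:E)%E)//.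
by apply: eq_integral => x _; rewrite /= ger0_norm// diag_ge0.
Qed.

Lemma rkhs_mul_integrable f g : H f -> H g ->
  nu.-integrable setT (EFin \o (fun x : borel_type X => f x * g x)).
Proof.
move=> Hf Hg.
have Ik := integrableZl measurableT (N f * N g) diag_integrable.
apply: (le_integrable measurableT _ _ Ik).
- by apply/measurable_EFinP; apply: measurable_funM; exact: H_meas.
- move=> x _ /=; rewrite lee_fin (le_trans (rkhs_mul_le x Hf Hg))//.
  exact: ler_norm.
Qed.

Lemma rkhs_Lfun2 f : H f -> (f : borel_type X -> R) \in Lfun nu 2%:E.
Proof.
move=> Hf; apply: Lfun2P; first exact: H_meas.
have /integrableP[_] := rkhs_mul_integrable Hf Hf; apply: le_lt_trans.
rewrite le_eqVlt; apply/orP; left; apply/eqP; apply: eq_integral => x _.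
by rewrite /= ger0_norm ?sqr_ge0.
Qed.

Definition L2_form f g : R := Rintegral nu setT (fun x => f x * g x).
Local Notation q := L2_form.

Lemma L2_formC f g : q f g = q g f.
Proof. by congr Rintegral; apply/funext => x; rewrite mulrC. Qed.

Lemma L2_form_lin (a : R) f g h : H f -> H g -> H h ->
  q (fun x => a * f x + g x) h = a * q f h + q g h.
Proof.
move=> Hf Hg Hh.
have [Ifh Igh] := (rkhs_mul_integrable Hf Hh, rkhs_mul_integrable Hg Hh).
have Iafh := rkhs_mul_integrable (hilbert_scale hH a Hf) Hh.
have -> : q (fun x => a * f x + g x) h =
    Rintegral nu setT (fun x => a * f x * h x + g x * h x).
  by congr Rintegral; apply/funext => x; rewrite mulrDl.
have -> := RintegralD measurableT Iafh Igh; congr (_ + _).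
have <- := RintegralZl a measurableT Ifh.
by congr Rintegral; apply/funext => x; rewrite mulrA.
Qed.

Lemma L2_form_le f g : H f -> H g ->
  `|q f g| <= N f * N g * Rintegral nu setT (fun x => k x x).
Proof.
move=> Hf Hg; have I := rkhs_mul_integrable Hf Hg.
apply: (le_trans (le_normr_Rintegral measurableT I)).
have <- := RintegralZl (N f * N g) measurableT diag_integrable.
apply: le_Rintegral => //.
- exact: integrable_norm.
- by have := integrableZl measurableT (N f * N g) diag_integrable.
- by move=> x _; exact: rkhs_mul_le.
Qed.

Lemma L2_form_ge0 f : 0 <= q f f.
Proof. by apply: Rintegral_ge0 => x _; rewrite -expr2 sqr_ge0. Qed.

Lemma L2_form_eq0 f : H f -> q f f = 0 -> f = fun=> 0.
Proof.
move=> Hf q0; have I := rkhs_mul_integrable Hf Hf.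
apply: (continuous_ae_eq nu_pos); [exact: H_cont|exact: cst_continuous|].
have : (\int[nu]_x `|(f x * f x)%:E|)%E = 0%E.
  rewrite -[LHS]fineK; last first.
    have /integrableP[_ foo] := I; rewrite ge0_fin_numE//.
    by apply: integral_ge0 => x _; exact: abse_ge0.
  rewrite -[RHS]/(0%:E) -q0; congr (_ %:E); congr fine; apply: eq_integral => x _.
  by rewrite abse_EFin ger0_norm// -expr2 sqr_ge0.
have mff : measurable_fun setT (EFin \o (fun x : borel_type X => f x * f x)).
  by apply/measurable_EFinP; apply: measurable_funM; exact: H_meas.
move/(ae_eq_integral_abs nu measurableT mff); apply: filterS => x /= + _.
by move=> /(_ Logic.I)[] /eqP; rewrite mulf_eq0 orbb => /eqP.
Qed.

(** The form [q] with second argument [g] is bounded on H. Its representer has at [y] the value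
    [q (k y) g], which is the integral defining the operator; hence the pointwise formula itself,
    and not just some representative of its class, lies in H. *)
Lemma kernel_operator_adjoint g : H g ->
  H (kernel_operator nu k g) /\
  forall h, H h -> q h g = ip h (kernel_operator nu k g).
Proof.
move=> Hg; pose C := (N g * Rintegral nu setT (fun x => k x x)) ^+ 2.
have q_lin a v w : H v -> H w -> q (fun x => a * v x + w x) g = a * q v g + q w g.
  by move=> Hv Hw; exact: L2_form_lin.
have q_le v : H v -> q v g ^+ 2 <= C * ip v v.
  move=> Hv; rewrite /C -(sqr_ip_norm hH)// -exprMn -[q v g ^+ 2]real_normK ?num_real//.
  rewrite ler_pXn2r ?nnegrE//.
    by rewrite (le_trans (L2_form_le Hv Hg))// -mulrA mulrC.
  rewrite !mulr_ge0 ?ip_norm_ge0//; apply: Rintegral_ge0 => x _; exact: diag_ge0.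
have [f [Hf _ fE]] := riesz_representation hH (@subset_refl _ H) (hilbert_zero hH)
  (hilbert_lin hH) q_lin q_le.
have -> : kernel_operator nu k g = f.
  apply/funext => y; have [[ksym _] _ _ _] := kC0.
  rewrite (rkhs_reproducing rkhsH y Hf) -fE//.
  by congr Rintegral; apply/funext => x; rewrite ksym.
by split => // h Hh; rewrite fE// (hilbert_ip_sym hH).
Qed.

Lemma L2_form_weak_cvg (f : nat -> X -> R) g : (forall n, H (f n)) ->
  (forall n, ip (f n) (f n) <= 1) -> H g ->
  (forall y, H y -> ip (f n) y @[n --> \oo] --> ip g y) ->
  q (f n) (f n) @[n --> \oo] --> q g g.
Proof.
move=> Hf f1 Hg fg.
have N1 n : N (f n) <= 1 by rewrite -[leRHS]sqrtr1 ler_wsqrtr.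
have mf h : H h -> measurable_fun setT (EFin \o (fun x : borel_type X => h x * h x)).
  by move=> Hh; apply/measurable_EFinP; apply: measurable_funM; exact: H_meas.
have fx x : f n x @[n --> \oo] --> g x.
  rewrite (rkhs_reproducing rkhsH x Hg).
  rewrite (_ : (fun n => f n x) = (fun n => ip (f n) (k x))); first exact/fg/Hk.
  by apply/funext => n; rewrite -(rkhs_reproducing rkhsH x (Hf n)).
have ae_cvg : {ae nu, forall x : borel_type X, setT x ->
    (f n x * f n x)%:E @[n --> \oo] --> (g x * g x)%:E}.
  by apply: aeW => x _; apply/cvg_EFin; [exact: nearW|exact: cvgM].
have ae_le : {ae nu, forall (x : borel_type X) n, setT x ->
    (`|(f n x * f n x)%:E| <= (k x x)%:E)%E}.
  apply: aeW => x n _ /=; rewrite lee_fin (le_trans (rkhs_mul_le x (Hf n) (Hf n)))//.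
  by rewrite ler_piMl ?diag_ge0// mulr_ile1 ?ip_norm_ge0.
have [_ _] := @dominated_convergence _ _ _ nu setT measurableT
  (fun n => EFin \o (fun x : borel_type X => f n x * f n x))
  (EFin \o (fun x : borel_type X => g x * g x))
  (EFin \o (fun x : borel_type X => k x x))
  (fun n => mf _ (Hf n)) (mf _ Hg) ae_cvg diag_integrable ae_le.
have Ig := integrable_fin_num measurableT (rkhs_mul_integrable Hg Hg).
move=> c; apply: (fine_cvg (f := fun n => (\int[nu]_x (f n x * f n x)%:E)%E)).
by rewrite /q /Rintegral fineK.
Qed.

(* A maximiser of the compact form [q] on the unit ball of a closed subspace
   that is invariant under the integral operator is an eigenvector. *)
Lemma L2_form_eigenvector (H0 : set (X -> R)) :
  H0 `<=` H -> H0 (fun=> 0) ->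
  (forall a f g, H0 f -> H0 g -> H0 (fun x => a * f x + g x)) ->
  (forall (f : nat -> X -> R) g, (forall n, H0 (f n)) -> H g ->
    (forall y, H y -> ip (f n) y @[n --> \oo] --> ip g y) -> H0 g) ->
  (forall f, H0 f -> H0 (kernel_operator nu k f)) ->
  (exists2 f, H0 f & f <> fun=> 0) ->
  exists g M, [/\ H0 g, g <> fun=> 0, 0 < M &
    kernel_operator nu k g = fun x => M * g x].
Proof.
move=> H0H H00 H0lin H0closed H0inv [f1 H0f1 f1_neq0].
pose B := [set f | H0 f /\ ip f f <= 1].
pose S := [set q f f | f in B].
pose K := Rintegral nu setT (fun x => k x x).
have K0 : 0 <= K by apply: Rintegral_ge0 => x _; exact: diag_ge0.
have q_leK f : B f -> q f f <= K.
  move=> [/H0H Hf f_le1]; rewrite (le_trans (ler_norm _))//.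
  rewrite (le_trans (L2_form_le Hf Hf))// -expr2 (sqr_ip_norm hH)//.
  by rewrite ler_piMl.
have B0 : B (fun=> 0).
  by split => //; rewrite (ip0l hH) ?ler01//; exact: (hilbert_zero hH).
have S_sup : has_sup S.
  split; first by exists (q (fun=> 0) (fun=> 0)), (fun=> 0).
  by exists K => _ [f Bf <-]; exact: q_leK.
pose M := sup S.
have q_leM f : B f -> q f f <= M by move=> Bf; apply: sup_upper_bound => //; exists f.
have H0scale a f : H0 f -> H0 (fun x => a * f x).
  move=> H0f; have := H0lin a f _ H0f H00.
  by under eq_fun do rewrite addr0.
have q_scale a f : H f -> q (fun x => a * f x) (fun x => a * f x) = a ^+ 2 * q f f.
  move=> Hf; have Haf := hilbert_scale hH a Hf; have Hz := hilbert_zero hH.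
  have qa h : H h -> q (fun x => a * f x) h = a * q f h.
    move=> Hh; have := L2_form_lin a Hf Hz Hh.
    rewrite (_ : (fun x => a * f x + 0) = (fun x => a * f x)); last first.
      by apply/funext => x; rewrite addr0.
    move=> ->; rewrite (_ : q (fun=> 0) h = 0) ?addr0//.
    rewrite /q (_ : (fun x => 0 * h x) = fun=> 0); last first.
      by apply/funext => x; rewrite mul0r.
    by rewrite Rintegral_cst// mul0r.
  by rewrite qa// L2_formC qa// expr2 mulrA.
have q_le f : H0 f -> q f f <= M * ip f f.
  move=> H0f; have Hf := H0H _ H0f.
  have [f0|f0] := eqVneq (ip f f) 0.
    rewrite f0 mulr0 (hilbert_ip_eq0 hH Hf f0).
    by rewrite /q (_ : (fun x => 0 * 0) = fun=> 0) ?Rintegral_cst ?mul0r//;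
      apply/funext => x; rewrite mul0r.
  have fp : 0 < ip f f by rewrite lt_def f0 (hilbert_ip_ge0 hH Hf).
  have Np : N f ^+ 2 = ip f f := sqr_ip_norm hH Hf.
  have := q_leM (fun x => (N f)^-1 * f x); rewrite q_scale// exprVn Np.
  rewrite ler_pdivrMl// mulrC; apply; split; first exact: H0scale.
  rewrite (ipZl hH) ?(ipZr hH)//; last exact: (hilbert_scale hH).
  by rewrite mulrA -expr2 exprVn Np mulVf.
(* Otherwise [q f1 f1 <= 0], while [q] is definite on H by continuity and strict positivity of
   [nu]. *)
have M_gt0 : 0 < M.
  rewrite ltNge; apply/negP => M0; apply: f1_neq0; apply: L2_form_eq0; first exact: H0H.
  apply/eqP; rewrite eq_le L2_form_ge0 andbT (le_trans (q_le _ H0f1))//.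
  by rewrite mulr_le0_ge0// (hilbert_ip_ge0 hH (H0H _ H0f1)).
have /choice[f fP] n : exists f, B f /\ M - n.+1%:R^-1 < q f f.
  have n0 : 0 < n.+1%:R^-1 :> R by rewrite invr_gt0.
  by have [_ [f Bf <-] lt] := sup_adherent n0 S_sup; exists f.
have H0f n : H0 (f n) := (fP n).1.1.
have Hf n : H (f n) := H0H _ (H0f n).
have [g [phi [Hg g1 phi_ge fg]]] :=
  weak_sequential_compactness hH Hf (fun n => (fP n).1.2).
have H0g : H0 g by exact: (H0closed (fun j => f (phi j))).
have qgM : q g g = M.
  apply/eqP; rewrite eq_le (q_leM _ (conj H0g g1))/=.
  have c := L2_form_weak_cvg (fun j => Hf (phi j)) (fun j => (fP (phi j)).1.2) Hg fg.
  apply/ler_addgt0Pr => eps eps0.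
  have /cvgr0Pnorm_lt /(_ eps eps0)[n0 _ n0P] := @cvg_harmonic R.
  rewrite -lerBlDr -(cvg_lim _ c)//; apply: limr_ge.
    by apply/cvg_ex; eexists; exact: c.
  exists n0 => // j /= n0j; have [_ /ltW] := fP (phi j); apply: le_trans.
  have := n0P (phi j) (leq_trans n0j (phi_ge j)).
  rewrite /= ger0_norm ?invr_ge0// => lt.
  by rewrite lerD2l lerN2 ltW.
exists g, M; split => //.
  move=> g0; move: M_gt0; rewrite -qgM g0 /q.
  by rewrite (_ : (fun x => 0 * 0) = fun=> 0) ?Rintegral_cst ?mul0r ?ltxx//;
    apply/funext => x; rewrite mul0r.
have [Hr rE] := kernel_operator_adjoint Hg.
pose r := kernel_operator nu k g.
have H0r : H0 r by exact: H0inv.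
pose h x := - M * g x + r x.
have H0h : H0 h by exact: H0lin.
have Hh := H0H _ H0h.
suff h0 : ip h h = 0.
  have := hilbert_ip_eq0 hH Hh h0 => hE; apply/funext => x.
  have := congr1 (fun f => f x) hE; rewrite /h mulNr => /eqP.
  by rewrite addrC subr_eq0 => /eqP.
have hhE : ip h h = q g h - M * ip g h.
  rewrite {1}/h (hilbert_ip_lin hH (- M) Hg Hr Hh) L2_formC rE//.
  by rewrite (hilbert_ip_sym hH Hr Hh) mulNr addrC.
pose a := ip h h.
have a0 : 0 <= a := hilbert_ip_ge0 hH Hh.
(* With [h] the defect [T g - M g], one has [a = ip h h = q g h - M * ip g h]. Inserting [t * h + g]
   into [q <= M * ip] and using [q g g = M] leaves this inequality. *)
have key t : 2 * t * a <= t ^+ 2 * (M * a).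
  have H0gt : H0 (fun x => t * h x + g x) by exact: H0lin.
  have Hgt := H0H _ H0gt; have Hth := hilbert_scale hH t Hh.
  have qE : q (fun x => t * h x + g x) (fun x => t * h x + g x) =
      t * (t * q h h + q g h) + (t * q g h + q g g).
    rewrite (L2_form_lin t Hh Hg Hgt) (L2_formC h (fun _ => _))
      (L2_formC g (fun _ => _)).
    by rewrite (L2_form_lin t Hh Hg Hh) (L2_form_lin t Hh Hg Hg) (L2_formC h g).
  have ipE : ip (fun x => t * h x + g x) (fun x => t * h x + g x) =
      t * (t * ip h h + ip g h) + (t * ip g h + ip g g).
    rewrite (hilbert_ip_lin hH t Hh Hg Hgt).
    rewrite (hilbert_ip_sym hH Hh Hgt) (hilbert_ip_sym hH Hg Hgt).
    rewrite (hilbert_ip_lin hH t Hh Hg Hh) (hilbert_ip_lin hH t Hh Hg Hg).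
    by rewrite (hilbert_ip_sym hH Hh Hg).
  have := q_le _ H0gt; rewrite qE ipE qgM => ineq.
  have qh0 := L2_form_ge0 h.
  have t2 : 0 <= t ^+ 2 * q h h by rewrite mulr_ge0 ?sqr_ge0.
  have Mg : M * ip g g <= M by rewrite ler_piMr// ltW.
  have := congr1 (fun z => t * z) hhE; rewrite -/a => ta.
  by move: ineq ta t2 Mg; rewrite -/a expr2; lra.
(* At [t = 1 / M] the inequality reads [2 * a / M <= a / M], so [a] cannot be positive. *)
have := key (M^-1); have M0 : M != 0 by rewrite gt_eqF.
rewrite (_ : M^-1 ^+ 2 * (M * a) = M^-1 * a); last by field.
have [a_gt0|a_le0] := ltP 0 a; last by move=> _; apply/eqP; rewrite eq_le a_le0.
rewrite -mulrA mulrCA ler_pM2l ?invr_gt0// -[leRHS]mul1r ler_pM2r//.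
by rewrite leNgt ltr1n.
Qed.

End rkhs_L2.

(** * Eigenfunctions and density of their span in the RKHS *)

Section eigenfunctions.
Context {R : realType} {X : ptopologicalType}.
Variable nu : {measure set (borel_type X) -> \bar R}.
Hypothesis nu_pos : strictly_positive nu.
Variables (k : X -> X -> R) (H : set (X -> R)) (ip : (X -> R) -> (X -> R) -> R).
Hypotheses (rkhsH : is_rkhs k H ip) (kC0 : C0_kernel k H)
  (k_int : (\int[nu]_x (k x x)%:E < +oo)%E).
Variables (I : eqType) (lam : I -> R) (e : I -> X -> R).
Hypothesis eigen : eigen_system nu k H ip lam e.
Local Notation N := (ip_norm ip).

Let hH : function_hilbert_space H ip := rkhs_hilbert rkhsH.

Let He i : H (e i) := eigen_rkhs eigen i.

Lemma rkhs_fun_span (A : set (X -> R)) : A `<=` H -> fun_span A `<=` H.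
Proof.
move=> AH _ [n [c [u [Au ->]]]]; apply: (ip_sum hH _ _ _ (hilbert_zero hH)).1.
by move=> j; exact: AH.
Qed.

Lemma eigen_span_C0 : range e `<=` C0.
Proof. by move=> _ [i _ <-]; have [_ _ _] := kC0; apply. Qed.

(** Both sides belong to H and are therefore continuous, so the almost everywhere equation holds at
    every point. *)
Lemma eigenfunction_everywhere i : kernel_operator nu k (e i) = fun x => lam i * e i x.
Proof.
have [Hr _] := kernel_operator_adjoint rkhsH kC0 k_int (He i).
have [_ _ _ HC] := kC0.
apply: (continuous_ae_eq nu_pos); first exact: (HC _ Hr).1.
  exact: (HC _ (hilbert_scale hH _ (He i))).1.
exact: eigen_eigen eigen i.
Qed.

Lemma eigen_orthogonal_eq0 f : H f -> (forall i, ip f (e i) = 0) -> f = fun=> 0.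
Proof.
move=> Hf f_e; apply: contrapT => f_neq0.
pose H0 := [set h | H h /\ forall i, ip h (e i) = 0].
have H0H : H0 `<=` H by move=> h [].
have H00 : H0 (fun=> 0).
  by split=> [|i]; [exact: (hilbert_zero hH)|exact: (ip0l hH)].
have H0lin a h h' : H0 h -> H0 h' -> H0 (fun x => a * h x + h' x).
  move=> [Hh h_e] [Hh' h'_e]; split=> [|i]; first exact: (hilbert_lin hH).
  by rewrite (hilbert_ip_lin hH)// h_e h'_e mulr0 addr0.
have H0closed (u : nat -> X -> R) g : (forall n, H0 (u n)) -> H g ->
    (forall y, H y -> ip (u n) y @[n --> \oo] --> ip g y) -> H0 g.
  move=> H0u Hg ug; split => // i; have := ug _ (He i).
  under eq_fun do rewrite (H0u _).2.
  by move=> c; exact: (cvg_unique _ c (cvg_cst _)).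
have H0inv h : H0 h -> H0 (kernel_operator nu k h).
  move=> [Hh h_e]; have [Hr rE] := kernel_operator_adjoint rkhsH kC0 k_int Hh.
  split => // i; have [_ eE] := kernel_operator_adjoint rkhsH kC0 k_int (He i).
  (* The operator moves across: [ip (T h) e_i = q e_i h = q h e_i = ip h (T e_i) = lam_i * ip h
     e_i], which is 0. *)
  rewrite (hilbert_ip_sym hH Hr (He i)) -rE// L2_formC eE// eigenfunction_everywhere.
  by rewrite (ipZr hH)// h_e mulr0.
have H0f : exists2 f1, H0 f1 & f1 <> fun=> 0 by exists f.
have [g [M [[Hg g_e] g_neq0 M_gt0 gE]]] :=
  L2_form_eigenvector nu_pos rkhsH kC0 k_int H0H H00 H0lin H0closed H0inv H0f.
have [||u eu gu] := eigen_all eigen (a := M) (f := g) _ (rkhs_Lfun2 rkhsH kC0 k_int Hg).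
- by rewrite gt_eqF.
- by rewrite /eigen_eq gE; exact: aeW.
have eH : e @` [set i | lam i = M] `<=` H by move=> _ [i _ <-].
have Hu := rkhs_fun_span eH eu.
have [_ _ _ HC] := kC0.
have {gu} gu := continuous_ae_eq nu_pos (HC _ Hg).1 (HC _ Hu).1 gu.
(* [g] is now a combination of the [e_i] with [lam i = M] and also orthogonal to each of them, so
   [ip g g = 0]. *)
apply: g_neq0; apply: (hilbert_ip_eq0 hH Hg).
rewrite {1}gu; case: eu => n [c [v [ev ->]]].
have Hv j : H (v j) by exact: eH.
have [_ ->] := ip_sum hH (index_enum _) c Hv Hg.
apply: big1 => j _; have [i _ <-] := ev j.
by rewrite (hilbert_ip_sym hH (He i) Hg) g_e mulr0.
Qed.

(** Representing [ip f] on the span yields the projection [p] of [f] onto its closure; [f - p] is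
    orthogonal to every [e_i], hence zero. *)
Lemma eigen_span_dense_rkhs f : H f ->
  exists2 u : nat -> X -> R, (forall n, fun_span (range e) (u n)) &
    N (fun x => u n x - f x) @[n --> \oo] --> (0 : R).
Proof.
move=> Hf; have eH : range e `<=` H by move=> _ [i _ <-].
have VH := rkhs_fun_span eH.
have f_lin a v w : fun_span (range e) v -> fun_span (range e) w ->
    ip f (fun x => a * v x + w x) = a * ip f v + ip f w.
  move=> /VH Hv /VH Hw.
  by rewrite (ipDr hH) ?(ipZr hH)//; exact: (hilbert_scale hH).
have f_le v : fun_span (range e) v -> ip f v ^+ 2 <= ip f f * ip v v.
  by move=> /VH Hv; exact: (sqr_ip_le hH).
have [p [Hp [u Vu up] fE]] := riesz_representation hH VH (fun_span0 (range e))
  (@fun_span_lin _ _ (range e)) f_lin f_le.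
exists u => //; suff -> : f = p by [].
have : (fun x => f x - p x) = fun=> 0.
  apply: eigen_orthogonal_eq0; first exact: (hilbert_sub hH).
  move=> i; rewrite (ipBl hH)// fE ?subrr//.
  by apply: sub_fun_span; exists i.
move=> fp; apply/funext => x; apply/eqP; rewrite -subr_eq0.
by rewrite -[f x - p x]/((fun x => f x - p x) x) fp.
Qed.

Lemma universal_kernelE : universal_kernel k H <-> sup_dense (fun_span (range e)) C0.
Proof.
have [ker [M kM] ck HC] := kC0.
have eH : range e `<=` H by move=> _ [i _ <-].
have VH := rkhs_fun_span eH.
split=> [[_ _ [_ Hdense]]|[_ edense]]; last first.
  split => //; split => // f Cf eps eps0; have [g eg lt] := edense f Cf eps eps0.
  by exists g => //; exact: VH.
split=> [|f Cf eps eps0]; first exact: C0_span eigen_span_C0.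
have eps2 : 0 < eps / 2 by rewrite divr_gt0.
have [h Hh fh] := Hdense f Cf _ eps2.
have [u eu uh] := eigen_span_dense_rkhs Hh.
have M0 : 0 <= M by rewrite (le_trans _ (kM point point)).
(* The sup norm is at most [sqrt M] times the norm of H; [M] may be 0, hence the added 1. *)
have s1 : 0 < Num.sqrt M + 1 by rewrite ltr_pwDr ?sqrtr_ge0.
have [n _ /(_ n (leqnn n))] : \forall n \near \oo,
    `|0 - N (fun x => u n x - h x)| < eps / 2 / (Num.sqrt M + 1).
  by move/cvgrPdist_lt : uh; apply; rewrite divr_gt0.
rewrite sub0r normrN ger0_norm ?ip_norm_ge0// ltr_pdivlMr// => lt.
exists (u n) => //.
have Hun := VH _ (eu n).
have Cfh := C0_sub Cf (HC _ Hh).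
have Huh := hilbert_sub hH Hun Hh.
have Chu := C0_scale (-1) (HC _ Huh).
rewrite (_ : (fun x => f x - u n x) =
  fun x => (f x - h x) + (-1) * (u n x - h x)); last by apply/funext => x; ring.
rewrite (le_lt_trans (sup_normD Cfh Chu))// [eps]splitr; apply: ltrD => //.
have -> : sup_norm (fun x => -1 * (u n x - h x)) = sup_norm (fun x => u n x - h x).
  by congr sup; apply/seteqP; split => _ [x _ <-]; exists x => //;
    rewrite mulN1r normrN.
have kM' x : k x x <= M by rewrite (le_trans (ler_norm _)).
rewrite (le_lt_trans (rkhs_sup_norm rkhsH kM' Huh))//.
by rewrite (le_lt_trans _ lt)// ler_wpM2l ?ip_norm_ge0// lerDl.
Qed.

End eigenfunctions.

(** * Density in L2 *)

Lemma regular_measure_squeeze {R : realType} {X : ptopologicalType}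
    (m : {finite_measure set (borel_type X) -> \bar R})
    (A : set (borel_type X)) (e : R) :
  hausdorff_space X -> regular_measure m -> measurable A -> 0 < e ->
  exists K O, [/\ compact K, open O, K `<=` A, A `<=` O & (m (O `\` K) < e%:E)%E].
Proof.
move=> hausX rm mA e0; have e2 : 0 < e / 2 by rewrite divr_gt0.
have [U [oU AU Ult]] := regular_measure_outer rm mA e2.
have [mAE _] := rm _ mA.
have fA : m A \is a fin_num by exact: fin_num_measure.
have [|_ [K [cK KA] <-]] := @ub_ereal_sup_adherent _
  [set m K | K in [set K : set X | compact K /\ K `<=` A]] _ e2; first by rewrite -mAE.
rewrite -mAE => lt; exists K, U; split => //.
have mK := closed_borel_measurable (compact_closed hausX cK).
have mU := open_borel_measurable oU.
have Kfin : m K \is a fin_num by exact: fin_num_measure.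
have Ufin : m U \is a fin_num by exact: fin_num_measure.
have -> : m (U `\` K) = (m U - m K)%E.
  rewrite measureD// ?setIidr//; first exact: subset_trans AU.
  by rewrite -ge0_fin_numE.
have lt' : fine (m A) - e / 2 < fine (m K) by rewrite -lte_fin EFinB !fineK.
have -> : (m U - m K)%E = (fine (m U) - fine (m K))%:E by rewrite EFinB !fineK.
by rewrite lte_fin; move: (fine (m U)) (fine (m A)) (fine (m K)) Ult lt' => *; lra.
Qed.

Section L2_density.
Context {R : realType} {X : ptopologicalType}.
Hypotheses (lcX : locally_compact [set: X]) (hausX : hausdorff_space X).
Variable nu : {measure set (borel_type X) -> \bar R}.
Variable m : {finite_measure set (borel_type X) -> \bar R}.
Hypotheses (rm : regular_measure m)
  (nu_le : forall A, measurable A -> (nu A <= m A)%E).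
Variable V : set (X -> R).
Hypotheses (Vlin : forall a f g, V f -> V g -> V (fun x => a * f x + g x))
  (V_dense : sup_dense V C0).

Local Notation T := (borel_type X).
(** The squared L_2 norm, with values in the extended reals, so that estimates need neither roots
    nor prior integrability. *)
Let D (f : T -> R) := (\int[nu]_x (f x ^+ 2)%:E)%E.

Let VC f : V f -> C0 f. Proof. by have [VC _] := V_dense; exact: VC. Qed.

Let V_meas f : V f -> measurable_fun setT (f : T -> R).
Proof. by move=> /VC Cf; exact: (continuous_borel_measurable Cf.1). Qed.

Let sq_meas (f : T -> R) : measurable_fun setT f ->
  measurable_fun setT (fun x => (f x ^+ 2)%:E).
Proof. by move=> mf; apply/measurable_EFinP; exact: measurable_funX. Qed.

(** Takes the place of the triangle inequality: with [(x + y)^2 <= 2 * x^2 + 2 * y^2] the pointwise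
    hypothesis holds for sums. *)
Let D_comb (f g h : T -> R) (a b s t : R) :
  measurable_fun setT f -> measurable_fun setT g -> measurable_fun setT h ->
  0 <= a -> 0 <= b -> (forall x, h x ^+ 2 <= a * f x ^+ 2 + b * g x ^+ 2) ->
  (D f < s%:E)%E -> (D g < t%:E)%E -> (D h <= (a * s + b * t)%:E)%E.
Proof.
move=> mf mg mh a0 b0 hfg fs gt_.
have sq0 (u : T -> R) x : (0 <= (u x ^+ 2)%:E)%E by rewrite lee_fin sqr_ge0.
apply: (@le_trans _ _ (\int[nu]_x (a%:E * (f x ^+ 2)%:E + b%:E * (g x ^+ 2)%:E))%E).
  apply: ge0_le_integral => //; first exact: sq_meas.
  - by apply: emeasurable_funD; apply: measurable_funeM; exact: sq_meas.
  - by move=> x _; rewrite -!EFinM -EFinD lee_fin.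
rewrite ge0_integralD//.
- rewrite !ge0_integralZl_EFin//; [|exact: sq_meas|exact: sq_meas].
  by rewrite EFinD !EFinM leeD// lee_wpmul2l ?lee_fin// ltW.
- by move=> x _; rewrite mule_ge0.
- by apply: measurable_funeM; exact: sq_meas.
- by move=> x _; rewrite mule_ge0.
- by apply: measurable_funeM; exact: sq_meas.
Qed.

Definition L2_closure : set (T -> R) := [set f : T -> R | measurable_fun setT f /\
  forall eps : R, 0 < eps -> exists2 g, V g & (D (fun x => f x - g x)%R < eps%:E)%E].

Local Notation G := L2_closure.

Let G_limit (f : T -> R) : measurable_fun setT f ->
  (forall eps : R, 0 < eps -> exists2 g, G g & (D (fun x => f x - g x)%R < eps%:E)%E) ->
  G f.
Proof.
(* [2 * (eps / 8) + 2 * (eps / 8)] is [eps / 2], which restores the strict inequality. *)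
move=> mf H; split => // eps eps0; have e8 : 0 < eps / 8 by rewrite divr_gt0.
have [g [mg Gg] fg] := H _ e8; have [u Vu gu] := Gg _ e8; exists u => //.
have mu := V_meas Vu.
apply: (@le_lt_trans _ _ (2 * (eps / 8) + 2 * (eps / 8))%:E); last first.
  by rewrite lte_fin; lra.
apply: (D_comb (f := fun x => f x - g x) (g := fun x => g x - u x)) => //;
  try exact: measurable_funB.
move=> x; have := sqr_ge0 ((f x - g x) - (g x - u x)).
by rewrite !expr2; lra.
Qed.

Let G_lin (a : R) f g : G f -> G g -> G (fun x => a * f x + g x).
Proof.
move=> [mf Gf] [mg Gg]; split.
  by apply: measurable_funD => //; exact: measurable_funM.
(* Chosen such that [2 * a ^+ 2 * s + 2 * s = eps / 2]. *)
move=> eps eps0; pose s := eps / (4 * (a ^+ 2 + 1)).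
have a1 : 0 < a ^+ 2 + 1 by rewrite ltr_wpDl ?sqr_ge0.
have s0 : 0 < s by rewrite divr_gt0// mulr_gt0.
have [[u Vu fu] [v Vv gv]] := (Gf _ s0, Gg _ s0).
have [mu mv] := (V_meas Vu, V_meas Vv).
exists (fun x => a * u x + v x); first exact: Vlin.
apply: (@le_lt_trans _ _ (2 * a ^+ 2 * s + 2 * s)%:E); last first.
  rewrite lte_fin (_ : _ + _ = eps / 2); first by lra.
  by rewrite /s; field; rewrite gt_eqF.
apply: (D_comb (f := fun x => f x - u x) (g := fun x => g x - v x)) => //.
- exact: measurable_funB.
- exact: measurable_funB.
- apply: measurable_funB; apply: measurable_funD => //; exact: measurable_funM.
- by rewrite mulr_ge0 ?sqr_ge0.
- move=> x; have := sqr_ge0 (a * (f x - u x) - (g x - v x)).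
  by rewrite !expr2; lra.
Qed.

Let nu_fin : nu setT \is a fin_num.
Proof.
rewrite ge0_fin_numE//; apply: le_lt_trans (nu_le measurableT) _.
by rewrite -ge0_fin_numE// fin_num_measure.
Qed.

Let G_C0 (f : X -> R) : C0 f -> G f.
Proof.
move=> Cf; split; first exact: (continuous_borel_measurable Cf.1).
move=> eps eps0; pose c := fine (nu setT).
have c0 : 0 <= c by exact: fine_ge0.
have c1 : 0 < c + 1 by rewrite ltr_pwDr.
(* The bound 1 gives [d ^+ 2 * c <= d * c], and the second bound makes this at most [eps / 2]. *)
pose d := Num.min 1 (eps / 2 / (c + 1)).
have d0 : 0 < d by rewrite lt_min ltr01 !divr_gt0.
have [g Vg lt] := V_dense.2 _ Cf _ d0; exists g => //.
have Cfg := C0_sub Cf (VC Vg).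
apply: (@le_lt_trans _ _ (\int[nu]_x (cst (d ^+ 2)%:E x))%E).
  apply: ge0_le_integral => //.
  - by move=> x _; rewrite lee_fin sqr_ge0.
  - exact: (sq_meas (continuous_borel_measurable Cfg.1)).
  - move=> x _; rewrite lee_fin -[leLHS]real_normK ?num_real//.
    rewrite ler_pXn2r ?nnegrE ?(ltW d0)//; apply: ltW; apply: le_lt_trans lt.
    exact: (ler_sup_norm x Cfg).
rewrite integral_cst// -(fineK nu_fin) -EFinM lte_fin -/c.
have d_le1 : d <= 1 by rewrite ge_min lexx.
have d_le : d * (c + 1) <= eps / 2 by rewrite -ler_pdivlMr// ge_min lexx orbT.
have d2 : d ^+ 2 * c <= d * c by rewrite ler_wpM2r// expr2 ler_piMr// ltW.
by move: d_le d2; rewrite mulrDr mulr1; lra.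
Qed.

(** A Urysohn function between a compact [K] inside [A] and an open [U] around [A] equals the
    indicator of [A] outside [U] minus [K] and differs from it by at most 1 there. The set [U] minus
    [K] is small for [m], hence for [nu]. *)
Let G_indic (A : set T) : measurable A -> G \1_A.
Proof.
move=> mA; apply: G_limit; first exact: measurable_indic.
move=> eps eps0.
have [K [U [cK oU KA AU lt]]] := regular_measure_squeeze hausX rm mA eps0.
have [u [Cu u01 uK uU]] := C0_urysohn (R := R) lcX hausX cK oU (subset_trans KA AU).
exists u; first exact: G_C0.
have mUK : measurable (U `\` K : set T).
  apply: measurableD; first exact: open_borel_measurable.
  exact: (closed_borel_measurable (compact_closed hausX cK)).
apply: le_lt_trans lt; apply: le_trans (nu_le mUK).
have -> : nu (U `\` K) = (\int[nu]_x (\1_(U `\` K) x)%:E)%E.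
  by rewrite integral_indic// setIT.
apply: ge0_le_integral => //.
- by move=> x _; rewrite lee_fin sqr_ge0.
- apply: sq_meas; apply: measurable_funB; first exact: measurable_indic.
  exact: (continuous_borel_measurable Cu.1).
- by apply/measurable_EFinP; exact: measurable_indic.
- move=> x _; rewrite lee_fin !indicE.
  have [Kx|nKx] := pselect (K x).
    rewrite uK// (mem_set (KA _ Kx)) memNset; last by case.
    by rewrite subrr expr0n.
  have [Ux|nUx] := pselect (U x); last first.
    rewrite uU// memNset; last by move=> /AU.
    by rewrite memNset; [rewrite subrr expr0n|case].
  rewrite (mem_set (conj Ux nKx : (U `\` K) x)).
  have /andP[u0 u1] := u01 x; have [xA|xA] := boolP (x \in A) => /=.
    by rewrite expr2 mulr_ile1; lra.
  by rewrite sub0r sqrrN expr2 mulr_ile1.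
Qed.

Import HBNNSimple.

Let G_nnsfun (h : {nnsfun T >-> R}) : G h.
Proof.
rewrite (_ : (h : T -> R) = fun x =>
    \sum_(y <- enum_fset (fset_set (range h))) y * \1_(h @^-1` [set y]) x); last first.
  by apply/funext => x; rewrite fimfunE fsbig_finite.
elim: (enum_fset _) => [|y s ih].
  under eq_fun do rewrite big_nil.
  by apply: G_C0; exact: C0_zero.
under eq_fun do rewrite big_cons.
by apply: G_lin => //; exact: G_indic.
Qed.

(** Simple functions [h n] increasing to [f] satisfy [(f - h n)^2 <= f^2], so dominated convergence
    applies to the squared distance. *)
Let G_pos (f : T -> R) : measurable_fun setT f -> (forall x, 0 <= f x) ->
  (D f < +oo)%E -> G f.
Proof.
move=> mf f0 Df; apply: G_limit => // eps eps0.
have mEf : measurable_fun setT (EFin \o f) by exact/measurable_EFinP.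
have f0' x : setT x -> (0 <= (EFin \o f) x)%E by rewrite lee_fin.
pose h := nnsfun_approx measurableT mEf.
have h_cvg x : h n x @[n --> \oo] --> f x.
  rewrite (_ : (fun n => h n x) = (fun n => approx setT (EFin \o f) n x)).
    exact: (cvg_approx f0' _ (ltry _)).
  by apply/funext => n; rewrite /h nnsfun_approxE.
have h_le n x : h n x <= f x.
  by rewrite -lee_fin /h nnsfun_approxE; exact: (le_approx n f0').
have mh n : measurable_fun setT (fun x => (((f x - h n x) ^+ 2)%:E : \bar R)).
  by apply: sq_meas; exact: measurable_funB.
have fi : nu.-integrable setT (fun x => (f x ^+ 2)%:E).
  apply/integrableP; split; first exact: sq_meas.
  apply: le_lt_trans Df; rewrite le_eqVlt; apply/orP; left; apply/eqP.
  by apply: eq_integral => x _; rewrite gee0_abs// lee_fin sqr_ge0.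
have ae_cvg : {ae nu, forall x, setT x ->
    ((f x - h n x) ^+ 2)%:E @[n --> \oo] --> cst (0%E : \bar R) x}.
  apply: aeW => x _; apply/cvg_EFin; first exact: nearW.
  have c : f x - h n x @[n --> \oo] --> f x - f x.
    by apply: cvgB; [exact: cvg_cst|exact: h_cvg].
  have := cvgM c c; rewrite subrr mulr0; exact.
have ae_le : {ae nu, forall x n, setT x ->
    (`|((f x - h n x) ^+ 2)%:E| <= (f x ^+ 2)%:E)%E}.
  apply: aeW => x n _; rewrite abse_EFin lee_fin ger0_norm ?sqr_ge0//.
  rewrite ler_pXn2r ?nnegrE ?subr_ge0//.
  by rewrite gerBl.
have [_ _] := dominated_convergence measurableT mh (measurable_cst _) ae_cvg fi ae_le.
rewrite integral0 => /fine_cvgP[fin_ /cvgr0Pnorm_lt /(_ eps eps0) near_].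
have [n0 _ /(_ n0 (leqnn _))[hfin hlt]] : \forall n \near \oo,
    D (fun x => f x - h n x) \is a fin_num /\
    `|fine (D (fun x => f x - h n x))| < eps.
  by apply: filterS2 fin_ near_ => n; split.
exists (h n0); first exact: G_nnsfun.
by rewrite -(fineK hfin) lte_fin (le_lt_trans (ler_norm _)).
Qed.

Theorem L2_dense_of_sup_dense (f : T -> R) : f \in Lfun nu 2%:E ->
  forall eps : R, 0 < eps ->
  exists2 g, V g & ('N[nu]_2%:E[EFin \o (fun x => f x - g x)%R] < eps%:E)%E.
Proof.
move=> f2; have mf := Lfun_measurable f2.
have /integrableP[_ Df] := Lfun2_integrable_sqr f2.
have {}Df : (D f < +oo)%E.
  apply: le_lt_trans Df; rewrite le_eqVlt; apply/orP; left; apply/eqP.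
  by apply: eq_integral => x _; rewrite /= ger0_norm ?sqr_ge0.
have part (g : T -> R) : measurable_fun setT g -> (forall x, 0 <= g x) ->
    (forall x, g x <= `|f x|) -> G g.
  move=> mg g0 gf; apply: G_pos => //; apply: le_lt_trans Df.
  apply: ge0_le_integral => //.
  - by move=> x _; rewrite lee_fin sqr_ge0.
  - exact: sq_meas.
  - exact: sq_meas.
  - move=> x _; rewrite lee_fin -[leRHS]real_normK ?num_real//.
    by rewrite ler_pXn2r ?nnegrE.
have Gp : G (fun x => Num.max (f x) 0).
  apply: part => [|x|x]; first exact: measurable_maxr.
    by rewrite le_max lexx orbT.
  by rewrite ge_max normr_ge0 ler_norm.
have Gn : G (fun x => Num.max (- f x) 0).
  apply: part => [|x|x].
  - by apply: measurable_maxr => //; exact: measurableT_comp.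
  - by rewrite le_max lexx orbT.
  - by rewrite ge_max normr_ge0 -normrN ler_norm.
have [_ Gf] := G_lin (-1) Gn Gp.
move=> eps eps0; have [g Vg lt] := Gf _ (exprn_gt0 2 eps0); exists g => //.
apply: Lnorm2_lt => //; apply: le_lt_trans lt; rewrite le_eqVlt; apply/orP; left.
apply/eqP; apply: eq_integral => x _; congr ((_ - _) ^+ 2)%:E.
have [f0|f0] := leP 0 (f x); first by rewrite max_r ?oppr_le0//; ring.
by rewrite max_l ?oppr_ge0 ?ltW//; ring.
Qed.

End L2_density.

Theorem theorem3p17 (R : realType) (X : ptopologicalType)
    (lcX : locally_compact [set: X]) (hausX : hausdorff_space X)
    (nu : {measure set (borel_type X) -> \bar R})
    (nu_borel : borel_measure nu) (nu_pos : strictly_positive nu)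
    (nu_sfin : sigma_finite [set: borel_type X] nu)
    (k : X -> X -> R)
    (H : set (X -> R)) (ip : (X -> R) -> (X -> R) -> R)
    (rkhsH : is_rkhs k H ip) (kC0 : C0_kernel k H)
    (k_int : (\int[nu]_x (k x x)%:E < +oo)%E)
    (I : countType) (lam : I -> R) (e : I -> X -> R)
    (eigen : eigen_system nu k H ip lam e) :
  let i_universal := universal_kernel k H in
  let ii_measures :=
    forall mu : {charge set (borel_type X) -> \bar R}, finite_signed_radon mu ->
      (forall i, charge_integral mu (e i) = 0) ->
      forall A, measurable A -> mu A = 0%E in
  let iii_dense := sup_dense (fun_span (range e)) C0 in
  [/\ i_universal <-> ii_measures,
      ii_measures <-> iii_dense &
      i_universal -> finite_signed_radon nu -> L2_orthonormal_basis nu e].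
Proof.
move=> i_universal ii_measures iii_dense.
have uE : i_universal <-> iii_dense.
  exact: (universal_kernelE nu_pos rkhsH kC0 k_int eigen).
have mE : ii_measures <-> iii_dense.
  apply: iff_trans (density_of_measures lcX hausX (eigen_span_C0 kC0 eigen)).
  (* Passes between annihilating each [e i] and annihilating each function in the range of [e]. *)
  split=> ann mu mu_radon mu_e; apply: (ann _ mu_radon).
    by move=> i; apply: mu_e; exists i.
  by move=> _ [i _ <-]; exact: mu_e.
split=> //; first by rewrite mE.
move=> /uE dense [m1 [m2 [r1 _ nuE]]]; split; first exact: eigen_L2 eigen.
(* Subtracting the non-negative [m2 A] only decreases [m1 A]. *)
have nu_le A : measurable A -> (nu A <= m1 A)%E.
  by move=> mA; rewrite nuE// geeDl// oppe_le0.
exact: (L2_dense_of_sup_dense lcX hausX r1 nu_le (@fun_span_lin _ _ (range e)) dense).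
Qed.
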